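(* Let $\mu_\Psi$ be a generalized Wright measure on $\mathcal{N}'$ with parameters as in the context (in particular $a^*\in(0,1)$). For $\varphi\in\mathcal{N}$ and $\lambda\in\mathbb{R}$ the function $\mathcal{N}'\ni\omega\mapsto\exp(|\lambda\langle\omega,\varphi\rangle|)$ is $\mu_\Psi$-integrable and $$l_{\mu_\Psi}(\lambda\varphi)=\int_{\mathcal{N}'}\mathrm{e}^{\lambda\langle\omega,\varphi\rangle}\,\mathrm{d}\mu_\Psi(\omega)=\frac1K\Psi\!\left(\frac{\lambda^2\langle\varphi,\varphi\rangle}{2}\right).$$ Furthermore, the map $l_{\mu_\Psi}(\cdot)$ is holomorphic from $\mathcal{N}_{\mathbb{C}}$ to $\mathbb{C}$, and for $\vartheta\in\mathcal{N}_{\mathbb{C}}$ and $z\in\mathbb{C}$ $$\int_{\mathcal{N}'}\exp(z\langle\omega,\vartheta\rangle)\,\mathrm{d}\mu_\Psi(\omega)=\frac1K\Psi\!\left(\frac{z^2\langle\vartheta,\vartheta\rangle}{2}\right).$$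
   Context: Parameters. $m,p\in\mathbb{N}_0=\{0,1,2,\dots\}$; $a_i\in\mathbb{R}$, $\alpha_i>0$, $a_i+\alpha_i>0$ for $i=1,\dots,p$; $b_j\in\mathbb{R}$, $\beta_j>0$, $b_j+\beta_j>0$ for $j=1,\dots,m$; $a^*:=\sum_{j=1}^m\beta_j-\sum_{i=1}^p\alpha_i\in(0,1)$; and the Fox-$H$ function $$H^{m,0}_{p,m}(\tau):=\frac{1}{2\pi\mathrm{i}}\int_{\gamma-\mathrm{i}\infty}^{\gamma+\mathrm{i}\infty}\frac{\prod_{j=1}^m\Gamma(b_j+\beta_js)}{\prod_{i=1}^p\Gamma(a_i+\alpha_is)}\,\tau^{-s}\,\mathrm{d}s,\qquad \tau>0,$$ is non-negative on $(0,\infty)$, where $\gamma\in(0,1)$ is such that all poles of the numerator lie to the left of the contour. Put $K:=\prod_{j=1}^m\Gamma(b_j+\beta_j)\big/\prod_{i=1}^p\Gamma(a_i+\alpha_i)$. The generalized Wright function is the entire function $\Psi(z)=\sum_{k\ge0}\frac{\prod_{j=1}^m\Gamma(b_j+\beta_j(k+1))}{\prod_{i=1}^p\Gamma(a_i+\alpha_i(k+1))}\frac{z^k}{k!}$, $z\in\mathbb{C}$. Nuclear triple. $\mathcal{H}$ is a real separable Hilbert space with norm $|\cdot|$; $\mathcal{N}=\bigcap_{l\in\mathbb{N}_0}\mathcal{H}_l$ is a nuclear space densely and continuously embedded in $\mathcal{H}$, the projective limit of real separable Hilbert spaces $\mathcal{H}_l$ with norms $|\cdot|_l$, $\mathcal{H}_0=\mathcal{H}$,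 $|\cdot|_l\le|\cdot|_{l+1}$, all inclusions $\mathcal{H}_{l+1}\subset\mathcal{H}_l$ being Hilbert–Schmidt. $\mathcal{N}'$ is its dual, $\mathcal{N}\subset\mathcal{H}\subset\mathcal{N}'$, with dual pairing $\langle\cdot,\cdot\rangle$ extending the inner product of $\mathcal{H}$; $\mathcal{C}_\sigma(\mathcal{N}')$ is the cylindrical $\sigma$-algebra. The subscript $\mathbb{C}$ denotes complexification, and $\langle\cdot,\cdot\rangle$ is extended as a bilinear form to $\mathcal{N}'_{\mathbb{C}}\times\mathcal{N}_{\mathbb{C}}$. The generalized Wright measure $\mu_\Psi$ is the unique probability measure on $(\mathcal{N}',\mathcal{C}_\sigma(\mathcal{N}'))$ with $\int_{\mathcal{N}'}\mathrm{e}^{\mathrm{i}\langle\omega,\varphi\rangle}\,\mathrm{d}\mu_\Psi(\omega)=\frac1K\Psi\big(-\tfrac{\langle\varphi,\varphi\rangle}{2}\big)$, $\varphi\in\mathcal{N}$. Its Laplace transform is $l_{\mu_\Psi}(\vartheta):=\int_{\mathcal{N}'}\exp(\langle\omega,\vartheta\rangle)\,\mathrm{d}\mu_\Psi(\omega)$, $\vartheta\in\mathcal{N}_{\mathbb{C}}$. *)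

(* Defs.v *)
From HB Require Import structures.
From mathcomp Require Import all_boot all_order all_algebra.
From mathcomp Require Import complex.
From mathcomp Require Import all_classical all_reals all_analysis.

Set Implicit Arguments.
Unset Strict Implicit.
Unset Printing Implicit Defensive.

Import Order.TTheory GRing.Theory Num.Theory.
Import numFieldNormedType.Exports.

Local Open Scope classical_set_scope.
Local Open Scope ring_scope.
Local Open Scope complex_scope.

Section ComplexAnalysis.
Context {R : realType}.

Definition expC (z : R[i]) : R[i] :=
  (expR (complex.Re z))%:C * (cos (complex.Im z) +i* sin (complex.Im z)).

Context d (T : measurableType d) (mu : {measure set T -> \bar R}).

Definition cintegrable (D : set T) (f : T -> R[i]) : Prop :=
  mu.-integrable D (EFin \o (@complex.Re R \o f)) /\
  mu.-integrable D (EFin \o (@complex.Im R \o f)).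

Definition cintegral (D : set T) (f : T -> R[i]) : R[i] :=
  (\int[mu]_(x in D) complex.Re (f x)) +i* (\int[mu]_(x in D) complex.Im (f x)).

End ComplexAnalysis.

Section Gamma.
Context {R : realType}.

(* int_0^oo t^(z-1) e^(-t) dt, for 0 < Re z. *)
Definition euler_integral (z : R[i]) : R[i] :=
  cintegral lebesgue_measure `]0%R, +oo[
    (fun t : R => expC ((z - 1) * (ln t)%:C - t%:C)).

(* The least n such that 0 < Re z + n. *)
Definition gamma_shift (z : R[i]) : nat :=
  if 0 < complex.Re z then 0%N else (Num.truncn (- complex.Re z)).+1.

(* Analytic continuation by Gamma(z) = Gamma(z + n) / (z (z+1) ... (z+n-1)).
   At a pole this is 0, as division by 0 yields 0; hence (Gamma z)^-1 is, for
   every z, the value at z of the entire function 1/Gamma. *)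
Definition Gamma (z : R[i]) : R[i] :=
  euler_integral (z + (gamma_shift z)%:R) /
  \prod_(k < gamma_shift z) (z + k%:R).

Context (p m : nat) (a alpha : 'I_p -> R) (b beta : 'I_m -> R).

Definition gamma_quotient (s : R[i]) : R[i] :=
  (\prod_(j < m) Gamma ((b j)%:C + (beta j)%:C * s)) /
  (\prod_(i < p) Gamma ((a i)%:C + (alpha i)%:C * s)).

(* int_(gamma - i oo)^(gamma + i oo) f(s) ds, with s = gamma + i t. *)
Definition vertical_integral (gamma : R) (f : R[i] -> R[i]) : R[i] :=
  cintegral lebesgue_measure setT (fun t : R => f (gamma +i* t) * 'i).

(* tau^(-s) = exp(- s ln tau), for 0 < tau. *)
Definition foxH (gamma tau : R) : R[i] :=
  ((2 * pi)%:C * 'i)^-1 *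
  vertical_integral gamma (fun s => gamma_quotient s * expC (- s * (ln tau)%:C)).

(* All poles of s |-> \prod_j Gamma (b j + beta j * s) lie to the left of the
   line Re s = gamma. *)
Definition poles_left_of (gamma : R) : Prop :=
  forall (s : R[i]) (j : 'I_m) (n : nat),
    (b j)%:C + (beta j)%:C * s = - n%:R -> complex.Re s < gamma.

Definition wrightK : R[i] := gamma_quotient 1.

Definition wright_term (z : R[i]) (k : nat) : R[i]^o :=
  gamma_quotient k.+1%:R * (z ^+ k / k`!%:R).

Definition wrightPsi (z : R[i]) : R[i] := limn (series (wright_term z)).

End Gamma.

Record separableHilbert (R : realType) := SeparableHilbert {
  hilbert_sort :> completeNormedModType R;
  inner : {dot hilbert_sort for idfun};
  inner_norm : forall x, inner x x = `|x| ^+ 2;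
  hilbert_separable : exists D : set hilbert_sort, countable D /\ dense D
}.

Section HilbertSchmidt.
Context {R : realType}.

Definition orthonormal_basis (U : separableHilbert R) (B : set U) : Prop :=
  (forall e f, B e -> B f -> inner U e f = (e == f)%:R) /\
  (forall x, (forall e, B e -> inner U x e = 0) -> x = 0).

Definition hilbert_schmidt (U V : separableHilbert R) (f : {linear U -> V}) :=
  exists B : set U, orthonormal_basis B /\
    (\esum_(e in B) (`|f e| ^+ 2)%:E < +oo)%E.

End HilbertSchmidt.

Section Dual.
Context {R : realType} (E : tvsType R).

Record dual := Dual {
  dual_fun : {linear E -> R^o};
  dual_continuous : continuous dual_fun
}.

HB.instance Definition _ := gen_eqMixin dual.
HB.instance Definition _ := gen_choiceMixin dual.

Lemma dual0_continuous : continuous (\0 : {linear E -> R^o}).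
Proof. by move=> x; exact: cst_continuous. Qed.

HB.instance Definition _ := isPointed.Build dual (Dual dual0_continuous).

Definition pairing (w : dual) (phi : E) : R := dual_fun w phi.

(* Generators of the smallest sigma-algebra for which all the evaluations
   w |-> <w, phi> are measurable. *)
Definition cylinder_base : set (set dual) :=
  [set C | exists (phi : E) (B : set R),
     measurable B /\ C = [set w | B (pairing w phi)]].

Definition cdual := g_sigma_algebraType cylinder_base.

End Dual.

Section Complexification.
Context {R : realType} (E : tvsType R).

(* (x, y) stands for x + i y. *)
Definition complexification : Type := (E * E)%type.

HB.instance Definition _ := Topological.copy complexification (E * E)%type.
HB.instance Definition _ := GRing.Zmodule.copy complexification (E * E)%type.

Definition cscale (z : R[i]) (v : complexification) : complexification :=
  (complex.Re z *: v.1 - complex.Im z *: v.2,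
   complex.Re z *: v.2 + complex.Im z *: v.1).

Lemma cscaleA (y z : R[i]) v : cscale y (cscale z v) = cscale (y * z) v.
Proof.
case: y z v => [yr yi] [zr zi] [v1 v2]; congr pair; rewrite /=;
  rewrite !scalerDl ?scalerBr ?scalerDr ?scalerN ?scaleNr !scalerA ?opprD.
- by rewrite -!addrA; congr (_ + _); rewrite addrA addrC.
- by rewrite -!addrA; congr (_ + _); rewrite addrA addrC.
Qed.

Lemma cscale1 : left_id 1 cscale.
Proof. by case=> v1 v2; rewrite /cscale /= !scale1r !scale0r subr0 addr0. Qed.

Lemma cscaleDr : right_distributive cscale +%R.
Proof.
move=> z [v1 v2] [w1 w2]; congr pair; rewrite /= !scalerDr ?opprD;
  exact: addrACA.
Qed.

Lemma cscaleDl v : {morph cscale^~ v : y z / y + z}.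
Proof.
case: v => v1 v2 [yr yi] [zr zi]; congr pair; rewrite /= !scalerDl ?opprD;
  exact: addrACA.
Qed.

HB.instance Definition _ := GRing.Zmodule_isLmodule.Build R[i] complexification
  cscaleA cscale1 cscaleDr cscaleDl.

Definition toC (x : E) : complexification := (x, 0).

(* The complex bilinear extension, restricted to real w. *)
Definition cpairing (w : dual E) (theta : complexification) : R[i] :=
  pairing w theta.1 +i* pairing w theta.2.

End Complexification.

Section Holomorphy.
Context {R : realType} (E : preTopologicalLmodType R[i]) (F : E -> R[i]).

(* Holomorphic means Gateaux-holomorphic and locally bounded, as is usual in
   infinite-dimensional holomorphy; over the scalar field R[i]^o, `derivable` is
   complex differentiability. *)
Definition G_holomorphic : Prop :=
  forall theta eta : E, forall z : R[i],
    derivable ((fun y => F (theta + y *: eta)) : R[i]^o -> R[i]^o) z 1.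

Definition locally_bounded : Prop :=
  forall theta : E, exists M : R[i],
    \forall eta \near theta, `|F eta| <= M.

Definition holomorphic : Prop := G_holomorphic /\ locally_bounded.

End Holomorphy.

(* The chain of Hilbert spaces is given by types linked by injective inclusion
   maps; N is their intersection, given by its inclusions into all of them and
   carrying the projective limit topology. *)
Record nuclearTriple (R : realType) := NuclearTriple {
  Hsp : nat -> separableHilbert R;
  incl : forall l, {linear Hsp l.+1 -> Hsp l};
  incl_inj : forall l, injective (incl l);
  incl_norm : forall l x, `|incl l x| <= `|x|;
  incl_hilbert_schmidt : forall l, hilbert_schmidt (incl l);
  Nsp : tvsType R;
  emb : forall l, {linear Nsp -> Hsp l};
  emb_inj : forall l, injective (emb l);
  emb_incl : forall l phi, incl l (emb l.+1 phi) = emb l phi;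
  emb_intersection : forall x : (forall l, Hsp l),
    (forall l, incl l (x l.+1) = x l) -> exists phi, forall l, emb l phi = x l;
  emb_nbhs : forall (phi : Nsp) (U : set Nsp),
    nbhs phi U <-> exists (l : nat) (e : R),
      0 < e /\ [set psi | `|emb l (psi - phi)| < e] `<=` U;
  emb_dense : dense (range (emb 0))
}.

Section WrightMeasure.
Context {R : realType} (T : nuclearTriple R).

Definition N_C := complexification (Nsp T).
HB.instance Definition _ := PreTopologicalLmodule.on N_C.

Definition inner0 (phi psi : Nsp T) : R :=
  inner (Hsp T 0) (emb T 0 phi) (emb T 0 psi).

(* The complex bilinear (not sesquilinear) extension of the inner product. *)
Definition cinner0 (theta eta : N_C) : R[i] :=
  (inner0 theta.1 eta.1 - inner0 theta.2 eta.2)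
    +i* (inner0 theta.1 eta.2 + inner0 theta.2 eta.1).

Context (mu : probability (cdual (Nsp T)) R).

Definition is_wright_measure (p m : nat) (a alpha : 'I_p -> R)
    (b beta : 'I_m -> R) : Prop :=
  forall phi : Nsp T,
    cintegral mu setT (fun w => expC ('i * (pairing w phi)%:C)) =
    (wrightK a alpha b beta)^-1 *
      wrightPsi a alpha b beta (- (inner0 phi phi)%:C / 2).

Definition laplace (theta : N_C) : R[i] :=
  cintegral mu setT (fun w => expC (cpairing w theta)).

End WrightMeasure.

(* Main.v *)
Require Import Defs.
From HB Require Import structures.
From mathcomp Require Import all_boot all_order all_algebra.
From mathcomp Require Import complex.
From mathcomp Require Import all_classical all_reals all_analysis.
From mathcomp Require Import measurable_realfun.
From mathcomp Require Import ring lra.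

Set Implicit Arguments.
Unset Strict Implicit.
Unset Printing Implicit Defensive.

Import Order.TTheory GRing.Theory Num.Theory.
Import numFieldNormedType.Exports.
Import ComplexField.Normc.

Local Open Scope classical_set_scope.
Local Open Scope ring_scope.
Local Open Scope complex_scope.

(** Fix [phi] in the nuclear space and let [X] be the random variable
    [w |-> <w, phi>]. Its characteristic function
    [t |-> K^-1 Psi(- t^2 <phi, phi> / 2)] is the restriction to the real line of an
    entire power series, and a probability law with such a characteristic function
    has exponential moments of every order, computed by the same series. The proof
    turns this principle into elementary estimates on real series.

    - [Psi] is entire ([entire_psi_coef]). Comparing Euler's integral with its
      integrand on an interval of length one, and with a geometric weight, shows that
      the quotient of Gamma functions grows at most like [n^(a* n)]; as [a* < 1], the
      factorial in the denominator wins.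

    - All moments of [X] exist and are read off from the series ([moment]). The Taylor
      remainders of the cosine have a constant sign, so Fatou's lemma applied to
      [cos_rem n (h X) / h^(2n)] as [h] tends to 0 bounds the moment of order [2n]
      by a coefficient of the series, and the same remainder bounds it from below.
      The odd moments vanish because the sine integrals do.

    - Summing the even moments gives [E (exp X + exp (- X)) < oo]
      ([rintegrable_exp_norm]).

    - For complex arguments take two vectors, with variables [X] and [Y]. For each real
      [v] the moments of [X + v Y] are known. They are polynomials in [v], hence the
      identity persists at [v = i] and gives the complex moments of [X + i Y]
      ([mixed_poly_i]). Dominated convergence along the partial sums of the exponential
      then yields the Laplace transform ([laplace_part], [laplace_formula]).

    - The Laplace transform is therefore an entire series composed with a continuous
      quadratic form. A termwise second-order Taylor estimate shows that the series is
      complex differentiable ([cpser_taylor]), and the norm of the Hilbert space bounds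
      the form locally ([holomorphic_laplace]). *)

(** * Euler's integral on the positive half-line *)

Section RealGamma.
Context {R : realType}.
Notation leb := (@lebesgue_measure R).

Definition gamma_integrand (y t : R) : R := expR ((y - 1) * ln t - t).

Definition rgamma (y : R) : R :=
  \int[leb]_(t in `]0%R, +oo[) gamma_integrand y t.

Lemma expC_real (x : R) : expC x%:C = (expR x)%:C.
Proof. by rewrite /expC /= cos0 sin0 mulr1. Qed.

(** At a positive real argument no shift occurs and Euler's integrand is real. *)
Lemma Gamma_real (y : R) : 0 < y -> Gamma y%:C = (rgamma y)%:C.
Proof.
move=> y0; rewrite /Gamma /gamma_shift /= y0 big_ord0 divr1 addr0.
rewrite /euler_integral /cintegral /rgamma.
have E t : expC ((y%:C - 1) * (ln t)%:C - t%:C) = (gamma_integrand y t)%:C.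
  by rewrite -expC_real -[1]/(1%:C) -!(rmorphB, rmorphM).
under eq_Rintegral do rewrite E /=.
rewrite [X in _ +i* X](_ : _ = 0) //.
under eq_Rintegral do rewrite E /=.
by rewrite Rintegral_cst// mul0r.
Qed.

Lemma measurable_gamma_integrand (y : R) (D : set R) : measurable D ->
  measurable_fun D (gamma_integrand y).
Proof.
move=> mD; apply: measurableT_comp => //; apply: measurable_funB => //.
by apply: measurable_funM => //; apply/measurable_funTS; exact: measurable_ln.
Qed.

(** The weight [t^(y-1)] is dominated through [ln u <= u] at [u = t / 2y], which
    uses up only half of the exponential decay. *)
Lemma gamma_integrand_le (y t : R) : 1 <= y -> 0 < t ->
  gamma_integrand y t <=
  2 * expR ((y - 1) * ln (2 * y)) * exponential_pdf 2^-1 t.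
Proof.
move=> y1 t0; rewrite (exponential_pdfE _ (ltW t0)) /gamma_integrand.
have -> : 2 * expR ((y - 1) * ln (2 * y)) * (2^-1 * expR (- 2^-1 * t)) =
    expR ((y - 1) * ln (2 * y) + - 2^-1 * t) by rewrite expRD; field.
rewrite ler_expR.
have y0 : 0 < y by apply: lt_le_trans y1.
have ly : ln (t / (2 * y)) < t / (2 * y).
  by apply: ln_sublinear; rewrite divr_gt0 // mulr_gt0.
rewrite ln_div ?posrE ?mulr_gt0// in ly.
have : (y - 1) * (ln t - ln (2 * y)) <= (y - 1) * (t / (2 * y)).
  by apply: ler_wpM2l; [rewrite subr_ge0|exact: ltW].
have : (y - 1) * (t / (2 * y)) <= t / 2.
  have -> : t / 2 = y * (t / (2 * y)) by field; rewrite gt_eqF.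
  by apply: ler_wpM2r; [rewrite divr_ge0 ?mulr_ge0 ?ltW// |lra].
by lra.
Qed.

Lemma gamma_integrable (y : R) : 1 <= y ->
  leb.-integrable `]0%R, +oo[ (EFin \o gamma_integrand y).
Proof.
move=> y1.
pose c := 2 * expR ((y - 1) * ln (2 * y)).
apply: (@le_integrable _ _ _ leb _ _ _ (EFin \o (fun t => c * exponential_pdf 2^-1 t))).
- exact: measurable_itv.
- by apply/measurable_EFinP; exact: measurable_gamma_integrand.
- move=> t; rewrite /= in_itv /= andbT => t0.
  rewrite lee_fin !ger0_norm ?expR_ge0 ?gamma_integrand_le//.
  by rewrite mulr_ge0 ?mulr_ge0 ?expR_ge0 ?exponential_pdf_ge0.
- apply: (@integrableS _ _ _ leb setT) => //.
  rewrite (_ : _ \o _ = (fun t => c%:E * (EFin \o exponential_pdf 2^-1) t)%E) //.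
  by apply: integrableZl => //; apply: integrable_exponential_pdf.
Qed.

Lemma rgamma_le (y : R) : 1 <= y -> rgamma y <= 2 * expR ((y - 1) * ln (2 * y)).
Proof.
move=> y1; set c := 2 * _.
have c0 : 0 <= c by rewrite mulr_ge0 ?expR_ge0.
rewrite /rgamma /Rintegral -lee_fin fineK; last first.
  by apply: integrable_fin_num; rewrite ?gamma_integrable//; exact: measurable_itv.
have mp : measurable_fun setT (EFin \o (@exponential_pdf R 2^-1)).
  by apply/measurable_EFinP; exact: measurable_exponential_pdf.
have p0 t : (0 <= (exponential_pdf 2^-1 t : R)%:E)%E by rewrite lee_fin exponential_pdf_ge0.
apply: (@le_trans _ _ (\int[leb]_(t in `]0%R, +oo[) (c%:E * (exponential_pdf 2^-1 t)%:E))%E).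
  apply: ge0_le_integral => //.
  - by move=> t _; rewrite lee_fin expR_ge0.
  - by apply/measurable_EFinP; exact: measurable_gamma_integrand.
  - by apply: measurable_funTS; apply: measurable_funeM.
  - move=> t; rewrite /= in_itv /= andbT => t0.
    by rewrite -EFinM lee_fin gamma_integrand_le.
rewrite ge0_integralZl //; last exact: measurable_funTS.
rewrite -[X in (_ <= X)%E]mule1; apply: lee_wpmul2l; rewrite ?lee_fin//.
rewrite -(@integral_exponential_pdf R 2^-1) //.
by apply: ge0_subset_integral.
Qed.

(** Only the mass on [[y, y + 1]] is kept. *)
Lemma rgamma_ge (y : R) : 1 <= y -> expR ((y - 1) * ln y - (y + 1)) <= rgamma y.
Proof.
move=> y1; set c := expR _.
have y0 : 0 < y by apply: lt_le_trans y1.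
rewrite /rgamma /Rintegral -lee_fin fineK; last first.
  by apply: integrable_fin_num; rewrite ?gamma_integrable//; exact: measurable_itv.
apply: (@le_trans _ _ (\int[leb]_(t in `[y, (y + 1)%R]) c%:E)%E).
  rewrite integral_cst //= lebesgue_measure_itv /= lte_fin ltrDl ltr01.
  by rewrite -EFinD -EFinM lee_fin addrAC subrr add0r mulr1.
apply: (@le_trans _ _ (\int[leb]_(t in `[y, (y + 1)%R]) (gamma_integrand y t)%:E)%E).
  apply: ge0_le_integral => //.
  - by move=> t _; rewrite lee_fin expR_ge0.
  - by apply/measurable_EFinP; exact: measurable_gamma_integrand.
  - move=> t; rewrite /= in_itv /= => /andP[yt ty].
    rewrite lee_fin ler_expR lerB//; apply: ler_wpM2l; first by rewrite subr_ge0.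
    by rewrite ler_ln ?posrE // (lt_le_trans y0).
apply: ge0_subset_integral => //.
- by apply/measurable_EFinP; exact: measurable_gamma_integrand.
- by move=> t _; rewrite lee_fin expR_ge0.
- move=> t /=; rewrite !in_itv /= => /andP[yt ty].
  by rewrite (lt_le_trans y0 yt).
Qed.

End RealGamma.

(** * Growth of Gamma quotients *)

Section Growth.
Context {R : realType}.

(** Growth of order [n ^ (s n)] up to a geometric factor: the orders of factors add,
    and both polynomial and exponential factors have order 0. *)
Definition has_growth (u : nat -> R) (s : R) : Prop :=
  exists C : R, \forall n \near \oo,
    0 <= u n <= expR (s * (n%:R * ln n%:R) + C * n%:R).

Lemma has_growthM u v s t :
  has_growth u s -> has_growth v t -> has_growth (u \* v) (s + t).
Proof.
move=> [C uC] [D vD]; exists (C + D); near=> n.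
have /andP[u0 uC'] : 0 <= u n <= expR (s * (n%:R * ln n%:R) + C * n%:R) by near: n.
have /andP[v0 vD'] : 0 <= v n <= expR (t * (n%:R * ln n%:R) + D * n%:R) by near: n.
rewrite mulr_ge0 //= (le_trans (ler_pM _ _ uC' vD'))//.
by rewrite -expRD !mulrDl addrACA.
Unshelve. all: by end_near. Qed.

Lemma has_growth_exp (r : R) : 0 <= r -> has_growth (fun n => r ^+ n) 0.
Proof.
move=> r0; exists r; near=> n; rewrite exprn_ge0//= mul0r add0r mulrC expRM_natl.
by apply: lerXn2r; rewrite ?nnegrE ?expR_ge0// (le_trans _ (expR_ge1Dx _)) ?lerDr.
Unshelve. all: by end_near. Qed.

Lemma has_growth_cst (r : R) : 0 <= r -> has_growth (fun=> r) 0.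
Proof.
move=> r0; exists r; near=> n; rewrite r0/= mul0r add0r.
rewrite (le_trans _ (expR_ge1Dx _))//.
have n1 : 1 <= n%:R :> R by rewrite ler1n; near: n; exists 1%N.
have : r * 1 <= r * n%:R by exact: ler_wpM2l.
by rewrite mulr1 => /le_trans -> //; rewrite lerDr.
Unshelve. all: by end_near. Qed.

Lemma has_growth_prod (k : nat) (u : 'I_k -> nat -> R) (s : 'I_k -> R) :
  (forall i, has_growth (u i) (s i)) ->
  has_growth (fun n => \prod_i u i n) (\sum_i s i).
Proof.
elim: k u s => [|k IH] u s us.
  rewrite big_ord0 (_ : (fun _ => _) = fun=> 1); first exact: has_growth_cst.
  by apply/funext => n; rewrite big_ord0.
rewrite big_ord_recl (_ : (fun _ => _) = u ord0 \* (fun n => \prod_i u (lift ord0 i) n)).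
  by apply: has_growthM => //; exact: IH.
by apply/funext => n; rewrite big_ord_recl.
Qed.

Lemma has_growth_id : has_growth (fun n => n%:R) 0.
Proof.
exists 1; near=> n; rewrite ler0n/= mul0r add0r mul1r.
by rewrite (le_trans _ (expR_ge1Dx _))// lerDr.
Unshelve. all: by end_near. Qed.

(** A crude Stirling bound; the induction step is [ln (1 + 1/k) <= 1/k]. *)
Lemma fact_ge (n : nat) : (0 < n)%N ->
  expR (n%:R * ln n%:R - n%:R) <= n`!%:R :> R.
Proof.
elim: n => // n IH _.
case: n IH => [_|n IH]; first by rewrite ln1 mulr0 sub0r expR_le1 lerN10.
set k := n.+1 in IH *.
have k0 : 0 < k%:R :> R by rewrite ltr0n.
have k10 : 0 < k.+1%:R :> R by rewrite ltr0n.
rewrite factS natrM; apply: le_trans (ler_wpM2l (ltW k10) (IH isT)).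
rewrite -[X in _ <= X * _](@lnK _ k.+1%:R) ?posrE// -expRD ler_expR.
have : ln (1 + k%:R^-1) <= k%:R^-1 :> R.
  by apply: le_ln1Dx; rewrite (lt_le_trans (ltrN10 _))// invr_ge0 ltW.
have -> : 1 + k%:R^-1 = k.+1%:R / k%:R :> R.
  by rewrite -natr1 mulrDl divff ?gt_eqF// div1r.
rewrite ln_div ?posrE// -(ler_pM2l k0) divff ?gt_eqF// mulrBr.
by rewrite -natr1; lra.
Qed.

Lemma has_growth_inv_fact : has_growth (fun n => (n`!%:R)^-1) (- 1).
Proof.
exists 1; near=> n.
rewrite invr_ge0 ler0n /= mulN1r mul1r addrC -opprB expRN.
rewrite lef_pV2 ?posrE ?expR_gt0 ?ltr0n ?fact_gt0//.
by apply: fact_ge; near: n; exists 1%N.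
Unshelve. all: by end_near. Qed.

(** With [y = b + beta n], replacing [(y - 1) ln y] by [beta n ln n] costs only a
    multiple of [n], which a geometric factor absorbs. This serves both for the upper
    bound, as [2 y <= L n], and for the lower one, as [L n <= y]. *)
Lemma log_linear_bound (b beta L : R) (n : nat) : (0 < n)%N -> 0 <= beta ->
  `|(b + beta * n%:R - 1) * (ln L + ln n%:R) - beta * (n%:R * ln n%:R)| <=
  (beta * `|ln L| + `|b - 1| * (`|ln L| + 1)) * n%:R.
Proof.
move=> n0 beta0.
have n1 : 1 <= n%:R :> R by rewrite ler1n.
have ln_n : `|ln n%:R| <= n%:R :> R.
  by rewrite ger0_norm ?ln_ge0// ltW// ln_sublinear// ltr0n.
have -> : (b + beta * n%:R - 1) * (ln L + ln n%:R) - beta * (n%:R * ln n%:R) =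
  beta * n%:R * ln L + (b - 1) * (ln L + ln n%:R) by ring.
rewrite (le_trans (ler_normD _ _))// (mulrDl (_ * _)) lerD//.
  by rewrite !normrM (ger0_norm beta0) normr_nat mulrAC.
rewrite normrM -mulrA ler_wpM2l// (le_trans (ler_normD _ _))// mulrDl mul1r.
by rewrite lerD// -[leLHS]mulr1 ler_wpM2l.
Qed.

Lemma affine_near_ge (b beta c : R) : 0 < beta ->
  \forall n \near \oo, c <= b + beta * n%:R.
Proof.
move=> beta0; near=> n.
rewrite -lerBlDl mulrC -ler_pdivrMr//.
by near: n; exact: nbhs_infty_ger.
Unshelve. all: by end_near. Qed.

Lemma has_growth_rgamma (b beta : R) : 0 < beta ->
  has_growth (fun n => rgamma (b + beta * n%:R)) beta.
Proof.
move=> beta0; pose L := 2 * (`|b| + beta).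
have L0 : 0 < L by rewrite mulr_gt0// ltr_wpDl.
exists (1 + (beta * `|ln L| + `|b - 1| * (`|ln L| + 1))).
near=> n; set y := b + _.
have y1 : 1 <= y by rewrite /y; near: n; exact: affine_near_ge.
have n0 : (0 < n)%N by near: n; exists 1%N.
have n1 : 1 <= n%:R :> R by rewrite ler1n.
have y0 : 0 < y by apply: lt_le_trans y1.
rewrite (le_trans _ (rgamma_ge y1)) ?expR_ge0//=.
apply: (le_trans (rgamma_le y1)).
have yL : 2 * y <= L * n%:R.
  rewrite /L -mulrA ler_pM2l// /y mulrDl lerD2r (le_trans (ler_norm _))//.
  by rewrite -[leLHS]mulr1 ler_wpM2l.
have ly : ln (2 * y) <= ln L + ln n%:R.
  have nR : 0 < n%:R :> R by rewrite ltr0n.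
  rewrite -lnM ?posrE// ler_ln ?posrE//; first by rewrite mulr_gt0.
  exact: mulr_gt0 L0 nR.
have /ler_normlW := log_linear_bound b L n0 (ltW beta0); rewrite -/y => B.
have e2 : 2 <= expR n%:R :> R by rewrite (le_trans _ (expR_ge1Dx _))//; lra.
apply: (le_trans (ler_wpM2r (expR_ge0 _) e2)); rewrite -expRD ler_expR.
have : (y - 1) * ln (2 * y) <= (y - 1) * (ln L + ln n%:R).
  by rewrite ler_wpM2l// subr_ge0.
by lra.
Unshelve. all: by end_near. Qed.

Lemma has_growth_rgammaV (a alpha : R) : 0 < alpha ->
  has_growth (fun n => (rgamma (a + alpha * n%:R))^-1) (- alpha).
Proof.
move=> alpha0; pose L := alpha / 2.
have L0 : 0 < L by rewrite divr_gt0.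
exists (`|a + 1| + alpha + (alpha * `|ln L| + `|a - 1| * (`|ln L| + 1))).
near=> n; set y := a + _.
have y1 : 1 <= y by rewrite /y; near: n; exact: affine_near_ge.
have n0 : (0 < n)%N by near: n; exists 1%N.
have n1 : 1 <= n%:R :> R by rewrite ler1n.
have y0 : 0 < y by apply: lt_le_trans y1.
have g0 : 0 < rgamma y by rewrite (lt_le_trans _ (rgamma_ge y1)) ?expR_gt0.
rewrite invr_ge0 (ltW g0) /= -[leRHS]invrK -expRN lef_pV2 ?posrE ?expR_gt0//.
apply: (le_trans _ (rgamma_ge y1)); rewrite ler_expR.
have yL : L * n%:R <= y.
  have : 0 <= a + L * n%:R by near: n; exact: affine_near_ge.
  by rewrite /y /L; lra.
have ly : ln L + ln n%:R <= ln y.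
  by rewrite -lnM ?posrE ?ltr0n// ler_ln ?posrE ?mulr_gt0 ?ltr0n.
have /lerNnormlW := log_linear_bound a L n0 (ltW alpha0); rewrite -/y => B.
have : (y - 1) * (ln L + ln n%:R) <= (y - 1) * ln y.
  by rewrite ler_wpM2l// subr_ge0.
have : a + 1 <= `|a + 1| * n%:R.
  by rewrite (le_trans (ler_norm _))// -[leLHS]mulr1 ler_wpM2l.
by move: B; rewrite /y; lra.
Unshelve. all: by end_near. Qed.

Lemma is_cvg_series_shift (N : nat) (u : nat -> R) :
  cvgn (series (fun k => u (k + N)%N)) <-> cvgn (series u).
Proof.
have E : series (fun k => u (k + N)%N) = (fun n => series u (n + N)%N - series u N).
  apply/funext => n; rewrite series_addn addrAC subrr add0r /series /= -{2}[N]add0n.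
  by rewrite big_addn addnK.
rewrite E; split=> [/cvg_ex[l cl]|/cvg_ex[l cl]]; apply/cvg_ex.
  exists (l + series u N); rewrite -(cvg_shiftn N).
  rewrite (_ : (fun _ => _) = (fun n => (series u (n + N)%N - series u N) + series u N)).
    by apply: cvgD => //; exact: cvg_cst.
  by apply/funext => n; rewrite subrK.
exists (l - series u N); apply: cvgB; last exact: cvg_cst.
by rewrite (cvg_shiftn N (series u)).
Qed.

Lemma near_series_le_cvg (u v : nat -> R) :
  (\forall n \near \oo, 0 <= u n <= v n) -> cvgn (series v) -> cvgn (series u).
Proof.
move=> [N _ uv] /(is_cvg_series_shift N v).2 cv; apply/(is_cvg_series_shift N u).
have {}uv k : 0 <= u (k + N)%N <= v (k + N)%N by apply: uv; rewrite /= leq_addl.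
apply: series_le_cvg cv => k; have /andP[u0 le] := uv k => //.
exact: le_trans le.
Qed.

(** Once [s ln n + C] drops below [- ln 2], the terms are smaller than [2 ^ -n]. *)
Lemma has_growth_summable (u : nat -> R) (s : R) :
  s < 0 -> has_growth u s -> cvgn (series u).
Proof.
move=> s0 [C uC]; apply: (@near_series_le_cvg _ (geometric 1 2^-1)); last first.
  by apply: is_cvg_geometric_series; rewrite ger0_norm; lra.
near=> n.
have /andP[-> uC'] /= : 0 <= u n <= expR (s * (n%:R * ln n%:R) + C * n%:R) by near: n.
have n0 : 0 < n%:R :> R by rewrite ltr0n; near: n; exists 1%N.
apply: (le_trans uC'); rewrite mul1r -[2^-1]lnK ?posrE ?invr_gt0// -expRM_natl ler_expR.
have -> : s * (n%:R * ln n%:R) + C * n%:R = n%:R * (s * ln n%:R + C) by ring.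
rewrite ler_pM2l//.
have : expR ((ln 2^-1 - C) / s) <= n%:R by near: n; exact: nbhs_infty_ger.
rewrite -{1}[n%:R]lnK ?posrE// ler_expR ler_ndivrMr//.
by lra.
Unshelve. all: by end_near. Qed.

End Growth.

(** * Entire series and the Wright function *)

Section EntireSeries.
Context {R : realType}.

(** Coefficients of a power series with infinite radius of convergence. *)
Definition entire (c : nat -> R) : Prop :=
  forall r : R, 0 <= r -> cvgn (series (fun k => `|c k| * r ^+ k)).

Definition majorant (c : nat -> R) (r : R) : R :=
  limn (series (fun k => `|c k| * r ^+ k)).

Lemma is_cvg_seriesM (A : R) (u : nat -> R) :
  cvgn (series u) -> cvgn (series (fun k => A * u k)).
Proof. exact: is_cvg_seriesZ. Qed.

Lemma lim_seriesM (A : R) (u : nat -> R) : cvgn (series u) ->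
  limn (series (fun k => A * u k)) = A * limn (series u).
Proof. exact: lim_seriesZ. Qed.

Lemma cvg_series_entire (c w : nat -> R) (A r : R) : entire c -> 0 <= r ->
  (forall k, `|w k| <= A * r ^+ k) -> cvgn (series (fun k => c k * w k)).
Proof.
move=> ec r0 wr; apply: normed_cvg.
apply: (@series_le_cvg _ _ (fun k => A * (`|c k| * r ^+ k))) => [k|k|k|] /=.
- exact: normr_ge0.
- by rewrite mulrCA mulr_ge0// (le_trans _ (wr k)).
- by rewrite normrM mulrCA ler_wpM2l.
- exact: is_cvg_seriesM (ec r r0).
Qed.

Lemma lim_series_entire_le (c w : nat -> R) (A r : R) : entire c -> 0 <= r ->
  (forall k, `|w k| <= A * r ^+ k) ->
  `|limn (series (fun k => c k * w k))| <= A * majorant c r.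
Proof.
move=> ec r0 wr.
have cA : cvgn (series (fun k => A * (`|c k| * r ^+ k))).
  exact: is_cvg_seriesM (ec r r0).
have le k : `|c k * w k| <= A * (`|c k| * r ^+ k).
  by rewrite normrM mulrCA ler_wpM2l.
have cn : cvgn [normed series (fun k => c k * w k)].
  apply: series_le_cvg cA => k /=; [exact: normr_ge0|idtac|exact: le].
  exact: le_trans (le k).
apply: (le_trans (lim_series_norm cn)).
apply: (le_trans (lim_series_le cn cA le)).
by rewrite /majorant lim_seriesM//; exact: ec.
Qed.

Lemma majorant_ge0 (c : nat -> R) r : entire c -> 0 <= r -> 0 <= majorant c r.
Proof.
move=> ec r0; apply: limr_ge; first exact: ec.
by apply: nearW => n; apply: sumr_ge0 => k _; rewrite mulr_ge0 ?exprn_ge0.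
Qed.

Lemma majorant_le (c : nat -> R) r s : entire c -> 0 <= r -> r <= s ->
  majorant c r <= majorant c s.
Proof.
move=> ec r0 rs; apply: lim_series_le; [exact: ec|by apply: ec; exact: le_trans rs|].
by move=> k; rewrite ler_wpM2l// lerXn2r// nnegrE// (le_trans r0).
Qed.

Lemma entireZ (a : R) (c : nat -> R) : entire c -> entire (fun k => a * c k).
Proof.
move=> ec r r0.
have -> : (fun k => `|a * c k| * r ^+ k) = (fun k => `|a| * (`|c k| * r ^+ k)).
  by apply/funext => k; rewrite normrM mulrA.
exact: is_cvg_seriesM (ec r r0).
Qed.

Lemma entire_scale (x : R) (c : nat -> R) : entire c -> entire (fun k => c k * x ^+ k).
Proof.
move=> ec r r0.
have -> : (fun k => `|c k * x ^+ k| * r ^+ k) = (fun k => `|c k| * (`|x| * r) ^+ k).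
  by apply/funext => k; rewrite exprMn normrM normrX mulrA.
by apply: ec; rewrite mulr_ge0.
Qed.

End EntireSeries.

Section ComplexLimits.
Context {R : realType}.
Implicit Types z : R[i].

Lemma normc_normE z : `|z| = (normc z)%:C. Proof. by []. Qed.

Lemma normc_real (x : R) : normc x%:C = `|x|.
Proof. by rewrite /= expr0n addr0 sqrtr_sqr. Qed.

Lemma normc_ge0 z : 0 <= normc z.
Proof. by case: z => x y; exact: sqrtr_ge0. Qed.

Lemma normcX z n : normc (z ^+ n) = normc z ^+ n.
Proof.
elim: n => [|n IH]; first by rewrite !expr0 normc1.
by rewrite !exprS normcM IH.
Qed.

Lemma Re_le_normc z : `|complex.Re z| <= normc z.
Proof. by have := normc_ge_Re z; rewrite lecR. Qed.

Lemma Im_le_normc z : `|complex.Im z| <= normc z.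
Proof.
case: z => x y /=; rewrite -sqrtr_sqr ler_wsqrtr//.
by rewrite lerDr sqr_ge0.
Qed.

Lemma normc_le_ReIm z : normc z <= `|complex.Re z| + `|complex.Im z|.
Proof.
rewrite {1}[z]complexE (le_trans (le_normcD _ _))// normcM !normc_real.
by rewrite (_ : normc 'i%C = 1) ?mul1r//= expr0n expr1n add0r sqrtr1.
Qed.

Lemma cvg_complex (u : nat -> R[i]) (x y : R) :
  (@complex.Re R) \o u @ \oo --> x -> (@complex.Im R) \o u @ \oo --> y ->
  (u : nat -> R[i]^o) @ \oo --> (x +i* y : R[i]^o).
Proof.
move=> /cvgrPdist_lt ux /cvgrPdist_lt uy; apply/cvgrPdist_lt => e e0.
have {e0} : 0 < complex.Re e /\ e = (complex.Re e)%:C.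
  move: e e0 => [er ei]; rewrite ltcE /= => /andP[/eqP-> ?]; split => //.
move=> [e0 ->].
have e2 : 0 < complex.Re e / 2 by rewrite divr_gt0.
near=> n; rewrite normc_normE ltcR (le_lt_trans (normc_le_ReIm _))//.
rewrite [ltRHS]splitr ltrD//.
  have : `|x - ((@complex.Re R) \o u) n| < complex.Re e / 2 by near: n; exact: ux.
  by rewrite /=; case: (u n).
have : `|y - ((@complex.Im R) \o u) n| < complex.Re e / 2 by near: n; exact: uy.
by rewrite /=; case: (u n).
Unshelve. all: by end_near. Qed.

End ComplexLimits.

Section ComplexParts.
Context {R : realType}.

Lemma Re_realM (x : R) (z : R[i]) : complex.Re (x%:C * z) = x * complex.Re z.
Proof. by case: z => u v /=; rewrite mul0r subr0. Qed.

Lemma Im_realM (x : R) (z : R[i]) : complex.Im (x%:C * z) = x * complex.Im z.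
Proof. by case: z => u v /=; rewrite mul0r addr0. Qed.

Lemma Re_sum I (s : seq I) (F : I -> R[i]) :
  complex.Re (\sum_(i <- s) F i) = \sum_(i <- s) complex.Re (F i).
Proof. by apply: (big_morph _ _ erefl) => -[? ?] [? ?]. Qed.

Lemma Im_sum I (s : seq I) (F : I -> R[i]) :
  complex.Im (\sum_(i <- s) F i) = \sum_(i <- s) complex.Im (F i).
Proof. by apply: (big_morph _ _ erefl) => -[? ?] [? ?]. Qed.

End ComplexParts.

Section ComplexSeries.
Context {R : realType}.

(** The sum of [c k * W k] for real [c] and complex [W], by its real and imaginary
    parts, which are limits in the complete field of reals. *)
Definition cser (c : nat -> R) (W : nat -> R[i]) : R[i] :=
  limn (series (fun k => c k * complex.Re (W k)))
  +i* limn (series (fun k => c k * complex.Im (W k))).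

Variables (c : nat -> R) (W : nat -> R[i]) (A r : R).
Hypotheses (entire_c : entire c) (r_ge0 : 0 <= r).
Hypothesis W_le : forall k, normc (W k) <= A * r ^+ k.

Let ReW_le k : `|complex.Re (W k)| <= A * r ^+ k.
Proof. exact: le_trans (Re_le_normc _) (W_le k). Qed.

Let ImW_le k : `|complex.Im (W k)| <= A * r ^+ k.
Proof. exact: le_trans (Im_le_normc _) (W_le k). Qed.

Lemma cvg_cser : series (fun k => (c k)%:C * W k : R[i]^o) @ \oo --> (cser c W : R[i]^o).
Proof.
apply: cvg_complex.
  rewrite (_ : _ \o _ = series (fun k => c k * complex.Re (W k))).
    exact: cvg_series_entire ReW_le.
  by apply/funext => n; rewrite /comp /series Re_sum; under eq_bigr do rewrite Re_realM.
rewrite (_ : _ \o _ = series (fun k => c k * complex.Im (W k))).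
  exact: cvg_series_entire ImW_le.
by apply/funext => n; rewrite /comp /series Im_sum; under eq_bigr do rewrite Im_realM.
Qed.

Lemma lim_cser : limn (series (fun k => (c k)%:C * W k : R[i]^o)) = cser c W.
Proof. by apply: cvg_lim; [exact: norm_hausdorff|exact: cvg_cser]. Qed.

Lemma normc_cser_le : normc (cser c W) <= 2 * (A * majorant c r).
Proof.
rewrite (le_trans (normc_le_ReIm _))// mulr2n mulrDl !mul1r lerD//.
  exact: lim_series_entire_le ReW_le.
exact: lim_series_entire_le ImW_le.
Qed.

End ComplexSeries.

Section ComplexPowerSeries.
Context {R : realType}.
Implicit Types (z : R[i]) (c : nat -> R).

Definition cpser c z : R[i] := cser c (fun k => z ^+ k).

Lemma normcX_le z k : normc (z ^+ k) <= 1 * normc z ^+ k.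
Proof. by rewrite normcX mul1r. Qed.

Lemma cpser_real c (x : R) : cpser c x%:C = (limn (series (fun k => c k * x ^+ k)))%:C.
Proof.
rewrite /cpser /cser.
have E k : x%:C ^+ k = (x ^+ k)%:C by rewrite rmorphXn.
congr (_ +i* _).
  by congr (limn (series _)); apply/funext => k; rewrite E.
rewrite (_ : series _ = fun=> 0) ?lim_cst//.
by apply/funext => n; rewrite /series /= big1// => k _; rewrite E /= mulr0.
Qed.

Lemma lim_cpser c z : entire c ->
  limn (series (fun k => (c k)%:C * z ^+ k : R[i]^o)) = cpser c z.
Proof. by move=> ec; exact: lim_cser ec (normc_ge0 z) (normcX_le z). Qed.

Lemma cpserZ (a : R) c z : entire c -> cpser (fun k => a * c k) z = a%:C * cpser c z.
Proof.
move=> ec.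
have cv : series (fun k => (a * c k)%:C * z ^+ k : R[i]^o) @ \oo --> (a%:C * cpser c z : R[i]^o).
  rewrite (_ : series _ = (fun n => a%:C * series (fun k => (c k)%:C * z ^+ k) n)).
    by apply: cvgM; [exact: cvg_cst|exact: cvg_cser ec (normc_ge0 z) (normcX_le z)].
  apply/funext => n; rewrite /series /= mulr_sumr; apply: eq_bigr => k _.
  by rewrite rmorphM mulrA.
rewrite -(lim_cpser _ (entireZ (a := a) ec)).
exact: (cvg_lim (@norm_hausdorff _ _) cv).
Qed.

Lemma normc_cpser_le c z : entire c -> normc (cpser c z) <= 2 * majorant c (normc z).
Proof.
by move=> ec; have := normc_cser_le ec (normc_ge0 z) (normcX_le z); rewrite mul1r.
Qed.

End ComplexPowerSeries.

Section WrightCoefficients.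
Context {R : realType} (p m : nat).
Variables (a alpha : 'I_p -> R) (b beta : 'I_m -> R).
Hypotheses (alpha_gt0 : forall i, 0 < alpha i) (a_alpha_gt0 : forall i, 0 < a i + alpha i).
Hypotheses (beta_gt0 : forall j, 0 < beta j) (b_beta_gt0 : forall j, 0 < b j + beta j).
Hypothesis astar_lt1 : \sum_j beta j - \sum_i alpha i < 1.

Definition rgamma_quotient (n : nat) : R :=
  (\prod_j rgamma (b j + beta j * n%:R)) * \prod_i (rgamma (a i + alpha i * n%:R))^-1.

Lemma gamma_quotient_real n : (0 < n)%N ->
  gamma_quotient a alpha b beta n%:R = (rgamma_quotient n)%:C.
Proof.
move=> n0; have n1 : 1 <= n%:R :> R by rewrite ler1n.
have pos (x y : R) : 0 < y -> 0 < x + y -> 0 < x + y * n%:R.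
  move=> y0 xy; apply: (lt_le_trans xy); rewrite lerD2l -[leLHS]mulr1.
  by rewrite ler_wpM2l// ltW.
have E (x y : R) : x%:C + y%:C * n%:R = (x + y * n%:R)%:C.
  by rewrite rmorphD rmorphM rmorph_nat.
rewrite /gamma_quotient /rgamma_quotient -prodfV rmorphM !rmorph_prod.
congr (_ * _); apply: eq_bigr => k _.
  by rewrite E Gamma_real// pos.
by rewrite E Gamma_real ?pos// fmorphV.
Qed.

Lemma rgamma_quotient_growth :
  has_growth (fun n => `|rgamma_quotient n|) (\sum_j beta j - \sum_i alpha i).
Proof.
have : has_growth rgamma_quotient (\sum_j beta j + \sum_i - alpha i).
  apply: has_growthM; apply: has_growth_prod => k; first exact: has_growth_rgamma.
  exact: has_growth_rgammaV.
rewrite sumrN => -[C uC]; exists C; near=> n.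
have /andP[q0 qC] : 0 <= rgamma_quotient n <=
    expR ((\sum_j beta j - \sum_i alpha i) * (n%:R * ln n%:R) + C * n%:R) by near: n.
by rewrite ger0_norm// q0.
Unshelve. all: by end_near. Qed.

Definition psi_coef (k : nat) : R := rgamma_quotient k.+1 / k`!%:R.

(** The quotient of Gamma functions has growth of order [a* = sum beta - sum alpha],
    and the factorial has order 1 > a*. The index is shifted to [n = k + 1], at the
    cost of a factor [n]. *)
Lemma entire_psi_coef : entire psi_coef.
Proof.
move=> r r0.
pose u := (fun n => `|rgamma_quotient n|) \* ((fun n : nat => n%:R)
  \* ((fun n : nat => (n`!%:R)^-1) \* (fun n => (r + 1) ^+ n))) : nat -> R.
have : cvgn (series u).
  apply: (@has_growth_summable _ _ (\sum_j beta j - \sum_i alpha i + (0 + (- 1 + 0)))).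
    by rewrite addr0 add0r subr_lt0.
  apply: has_growthM; first exact: rgamma_quotient_growth.
  apply: has_growthM; first exact: has_growth_id.
  apply: has_growthM; first exact: has_growth_inv_fact.
  by apply: has_growth_exp; rewrite addr_ge0.
move=> /(is_cvg_series_shift 1 u).2; apply: series_le_cvg => k.
- by rewrite mulr_ge0// exprn_ge0.
- by rewrite /u /= !mulr_ge0 ?invr_ge0 ?exprn_ge0 ?addr_ge0.
rewrite /u /= addn1 /psi_coef normrM -mulrA ler_wpM2l//.
rewrite ger0_norm ?invr_ge0// mulrA factS natrM invfM mulrA divff ?pnatr_eq0// mul1r.
rewrite ler_wpM2l ?invr_ge0// exprS -[leLHS]mul1r ler_pM ?exprn_ge0//.
  by rewrite lerDr.
by rewrite lerXn2r ?nnegrE ?addr_ge0// lerDl.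
Qed.

Definition wright_coef (k : nat) : R := (rgamma_quotient 1)^-1 * psi_coef k.

Lemma entire_wright_coef : entire wright_coef.
Proof. by apply: entireZ; exact: entire_psi_coef. Qed.

Lemma wrightPsi_cpser (z : R[i]) :
  (wrightK a alpha b beta)^-1 * wrightPsi a alpha b beta z = cpser wright_coef z.
Proof.
rewrite cpserZ; last exact: entire_psi_coef.
rewrite /wrightK -[1]/(1%:R) gamma_quotient_real// fmorphV; congr (_ * _).
rewrite -lim_cpser; last exact: entire_psi_coef.
rewrite /wrightPsi (_ : wright_term _ _ _ _ z = fun k => (psi_coef k)%:C * z ^+ k)//.
apply/funext => k.
rewrite /wright_term gamma_quotient_real// /psi_coef [in RHS]rmorphM fmorphV rmorph_nat.
by rewrite -mulrA; congr (_ * _); rewrite mulrC.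
Qed.

End WrightCoefficients.

(** * Taylor remainders of the trigonometric functions *)

Section TrigRemainders.
Context {R : realType}.

(** Up to sign, the remainders of the Taylor polynomials of [cos] and [sin] at 0;
    the sign is chosen so that for [n > 0] they are nonnegative on the half-line. *)
Fixpoint cos_rem (n : nat) (x : R) : R :=
  if n is n'.+1 then x ^+ n'.*2 / n'.*2`!%:R - cos_rem n' x else cos x.

Fixpoint sin_rem (n : nat) (x : R) : R :=
  if n is n'.+1 then x ^+ n'.*2.+1 / n'.*2.+1`!%:R - sin_rem n' x else sin x.

Lemma is_derive_monomial (n : nat) (x : R) :
  is_derive x 1 (fun y : R => y ^+ n.+1 / n.+1`!%:R) (x ^+ n / n`!%:R).
Proof.
have n0 : (n.+1)%:R != 0 :> R by rewrite pnatr_eq0.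
have -> : (fun y : R => y ^+ n.+1 / n.+1`!%:R) = (n.+1`!%:R)^-1 *: (id ^+ n.+1 : R -> R).
  by apply/funext => y; rewrite mulrC [RHS]/(_ * _) exprfctE.
apply: is_derive_eq; rewrite -[LHS]/(_ * (_ * _)) mulr1 factS natrM.
by rewrite invfM /= mulrACA mulVf// mul1r mulrC.
Qed.

Lemma is_derive_sin_rem n (x : R) : is_derive x 1 (sin_rem n) (cos_rem n x).
Proof.
elim: n => [|n IH] /=; first exact: is_derive_sin.
by apply: is_deriveB; exact: is_derive_monomial.
Qed.

Lemma is_derive_cos_rem n (x : R) : is_derive x 1 (cos_rem n.+1) (sin_rem n x).
Proof.
elim: n => [|n IH].
  rewrite (_ : cos_rem 1 = cst 1 - cos); last first.
    by apply/funext => y /=; rewrite expr0 divr1.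
  have H : is_derive x (1 : R) (cst (1 : R) - cos) (0 - - sin x) by apply: is_deriveB.
  by move: H; rewrite sub0r opprK.
change (is_derive x (1 : R) ((fun y : R => y ^+ n.*2.+2 / n.*2.+2`!%:R) - cos_rem n.+1)
  (x ^+ n.*2.+1 / n.*2.+1`!%:R - sin_rem n x)).
by apply: is_deriveB; exact: is_derive_monomial.
Qed.

Lemma sin_rem0 n : sin_rem n 0 = 0.
Proof. by elim: n => [|n IH] /=; rewrite ?sin0// IH expr0n /= mul0r subr0. Qed.

Lemma cos_rem0 n : cos_rem n.+1 0 = 0.
Proof.
elim: n => [|n IH] /=; first by rewrite expr0 cos0 divr1 subrr.
by move: IH => /= ->; rewrite expr0n /= mul0r subr0.
Qed.

Lemma cos_remN n x : cos_rem n (- x) = cos_rem n x.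
Proof.
elim: n => [|n IH] /=; first exact: cosN.
by rewrite IH -mul2n !exprM sqrrN.
Qed.

Lemma sin_remN n x : sin_rem n (- x) = - sin_rem n x.
Proof.
elim: n => [|n IH] /=; first exact: sinN.
by rewrite IH !exprS -mul2n !exprM sqrrN !mulNr opprB opprK addrC.
Qed.

Lemma ge0_of_derive_ge0 (f f' : R -> R) : f 0 = 0 ->
  (forall x : R, is_derive x (1 : R) f (f' x)) -> (forall x, 0 <= x -> 0 <= f' x) ->
  forall x, 0 <= x -> 0 <= f x.
Proof.
move=> f0 df f'0 x x0; rewrite -f0.
have dvb (y : R) : derivable f y 1 by case: (df y).
apply: (@ger0_derive1_ndecry R f 0) => //.
- move=> y; rewrite in_itv /= andbT => y0.
  by rewrite derive1E (@derive_val _ _ _ _ _ _ _ (df y)) f'0// ltW.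
- apply: continuous_subspaceT => y; apply: differentiable_continuous.
  exact/derivable1_diffP.
Qed.

(** Each remainder vanishes at 0 and is the derivative of the next one, so that
    nonnegativity propagates from [1 - cos x >= 0]. *)
Lemma trig_rem_ge0 n :
  (forall x, 0 <= cos_rem n.+1 x) /\ (forall x, 0 <= x -> 0 <= sin_rem n.+1 x).
Proof.
have sin_of n' : (forall x, 0 <= cos_rem n' x) -> forall x, 0 <= x -> 0 <= sin_rem n' x.
  move=> H; apply: (@ge0_of_derive_ge0 _ (cos_rem n')) => //.
  - exact: sin_rem0.
  - exact: is_derive_sin_rem.
elim: n => [|n [IHc IHs]].
  have c1 x : 0 <= cos_rem 1 x by rewrite /= expr0 divr1 subr_ge0 cos_le1.
  by split => //; exact: sin_of.
suff c x : 0 <= cos_rem n.+2 x by split => //; exact: sin_of.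
wlog x0 : x / 0 <= x.
  move=> H; have [/H//|x0] := leP 0 x.
  by rewrite -cos_remN H// oppr_ge0 ltW.
move: x x0; apply: (@ge0_of_derive_ge0 _ (sin_rem n.+1)) => //.
- exact: cos_rem0.
- exact: is_derive_cos_rem.
Qed.

Lemma cos_rem_ge0 n x : 0 <= cos_rem n.+1 x.
Proof. by have [] := trig_rem_ge0 n. Qed.

(** A term of the series minus the remainder is the next remainder. *)
Lemma cos_rem_le n x : cos_rem n.+1 x <= x ^+ n.+1.*2 / n.+1.*2`!%:R.
Proof. by have := cos_rem_ge0 n.+1 x; rewrite [cos_rem n.+2 x]/= subr_ge0. Qed.

Lemma cos_rem_sub_le n x :
  `|cos_rem n.+1 x - x ^+ n.+1.*2 / n.+1.*2`!%:R| <= x ^+ n.+2.*2 / n.+2.*2`!%:R.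
Proof.
have := cos_rem_ge0 n.+1 x; have := cos_rem_le n.+1 x.
by rewrite distrC => le ge; rewrite -[_ - cos_rem _ _]/(cos_rem n.+2 x) ger0_norm.
Qed.

Lemma sin_rem_le n x : `|sin_rem n.+1 x| <= `|x| ^+ n.+1.*2.+1 / n.+1.*2.+1`!%:R.
Proof.
wlog x0 : x / 0 <= x.
  move=> H; have [/H//|x0] := leP 0 x.
  by rewrite -normrN -sin_remN -[`|x|]normrN H// oppr_ge0 ltW.
have [_ s0] := trig_rem_ge0 n; have [_ s1] := trig_rem_ge0 n.+1.
rewrite (ger0_norm x0) (ger0_norm (s0 x x0)).
by have := s1 x x0; rewrite [sin_rem n.+2 x]/= subr_ge0.
Qed.

Lemma measurable_cos_rem n : measurable_fun setT (cos_rem n).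
Proof.
elim: n => [|n IH] /=; first by apply: continuous_measurable_fun; exact: continuous_cos.
apply: measurable_funB => //; exact: measurable_funM.
Qed.

Lemma measurable_sin_rem n : measurable_fun setT (sin_rem n).
Proof.
elim: n => [|n IH] /=; first by apply: continuous_measurable_fun; exact: continuous_sin.
apply: measurable_funB => //; exact: measurable_funM.
Qed.

End TrigRemainders.

Section SmallParameter.
Context {R : realType}.

Lemma le0_of_harmonic (x M : R) : (forall j : nat, x <= M * harmonic j) -> x <= 0.
Proof.
move=> H; have cM : M * harmonic j @[j --> \oo] --> (0 : R).
  by rewrite -(mulr0 M); apply: cvgM; [exact: cvg_cst|exact: cvg_harmonic].
by apply: (cvgr_to_ge cM); exact: nearW.
Qed.

(** The tail is compared with [u ^ N] times the sum of the absolute values of the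
    coefficients, as [u <= 1]. *)
Lemma entire_tail_le (c w : nat -> R) (u : R) N : entire c -> 0 <= u <= 1 ->
  (forall k, `|w k| <= u ^+ k) ->
  `|limn (series (fun k => c k * w k)) - \sum_(k < N) c k * w k|
    <= u ^+ N * majorant c 1.
Proof.
move=> ec /andP[u0 u1] wu.
pose v k := if (k < N)%N then 0 else w k.
have vu k : `|v k| <= u ^+ N * 1 ^+ k.
  rewrite expr1n mulr1 /v; case: ltnP => kN; first by rewrite normr0 exprn_ge0.
  by rewrite (le_trans (wu k))// ler_wiXn2l.
have cw : cvgn (series (fun k => c k * w k)).
  by apply: (cvg_series_entire ec u0 (A := 1)) => k; rewrite mul1r.
rewrite (_ : _ - _ = limn (series (fun k => c k * v k))); first exact: lim_series_entire_le.
apply/esym/cvg_lim => //; rewrite -(cvg_shiftn N).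
rewrite (_ : (fun _ => _) = (fun n => series (fun k => c k * w k) (n + N)%N -
    \sum_(k < N) c k * w k)).
  by apply: cvgB; [rewrite (cvg_shiftn N (series _))|exact: cvg_cst].
apply/funext => n; rewrite !seriesEord /= addnC !big_split_ord /=.
rewrite [X in X + _ = _]big1 ?add0r; last by move=> i _; rewrite /v ltn_ord mulr0.
rewrite addrAC subrr add0r; apply: eq_bigr => i _.
by rewrite /v ltnNge leq_addr.
Qed.

End SmallParameter.

(** * Moments from an entire characteristic function *)

Section RealIntegrable.
Context d (T : measurableType d) (R : realType) (mu : {measure set T -> \bar R}).
Implicit Types f g : T -> R.

Definition rintegrable f : Prop := mu.-integrable setT (EFin \o f).

Lemma rintegrable_le f g : measurable_fun setT f -> (forall w, `|f w| <= g w) ->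
  rintegrable g -> rintegrable f.
Proof.
move=> mf fg; apply: le_integrable => //; first exact/measurable_EFinP.
by move=> w _; rewrite /= lee_fin (le_trans (fg w))// ler_norm.
Qed.

Lemma rintegrableD f g : rintegrable f -> rintegrable g ->
  rintegrable (fun w => f w + g w).
Proof. by move=> If Ig; have := integrableD measurableT If Ig. Qed.

Lemma rintegrableB f g : rintegrable f -> rintegrable g ->
  rintegrable (fun w => f w - g w).
Proof. by move=> If Ig; have := integrableB measurableT If Ig. Qed.

Lemma rintegrableZ (a : R) f : rintegrable f -> rintegrable (fun w => a * f w).
Proof. by move=> If; have := integrableZl measurableT a If. Qed.

Lemma rintegrable_sum I (s : seq I) (F : I -> T -> R) :
  (forall i, rintegrable (F i)) -> rintegrable (fun w => \sum_(i <- s) F i w).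
Proof.
move=> IF; rewrite /rintegrable.
have := @integrable_sum _ _ _ mu setT measurableT _ s xpredT (fun i => EFin \o F i) (fun i _ => IF i).
by apply: eq_integrable => // w _; rewrite /= sumEFin.
Qed.

Lemma Rintegral_sum I (s : seq I) (F : I -> T -> R) :
  (forall i, rintegrable (F i)) ->
  \int[mu]_w (\sum_(i <- s) F i w) = \sum_(i <- s) \int[mu]_w F i w.
Proof.
move=> IF; elim: s => [|i s IH].
  rewrite big_nil; under eq_Rintegral do rewrite big_nil.
  by rewrite Rintegral_cst// mul0r.
under eq_Rintegral do rewrite big_cons.
rewrite RintegralD// ?IH ?big_cons//; first exact: IF.
exact: (rintegrable_sum s IF).
Qed.

Lemma measurable_rintegrable f : rintegrable f -> measurable_fun setT f.
Proof. by move=> /measurable_int/measurable_EFinP. Qed.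

(** Fatou's lemma; convergence of the integrals makes the lower limit a number, which
    yields integrability of the pointwise limit. *)
Lemma fatou_cvg (f : nat -> T -> R) g (l : R) :
  (forall j, rintegrable (f j)) -> (forall j w, 0 <= f j w) ->
  measurable_fun setT g -> (forall w, f ^~ w @ \oo --> g w) ->
  (fun j => \int[mu]_w f j w) @ \oo --> l ->
  rintegrable g /\ \int[mu]_w g w <= l.
Proof.
move=> If f0 mg fg fl.
have g0 w : 0 <= g w by apply: (cvgr_to_ge (fg w)); exact: nearW.
have le : (\int[mu]_w (g w)%:E <= l%:E)%E.
  have := @fatou _ _ _ mu setT measurableT (fun j w => (f j w)%:E).
  rewrite (_ : (fun w => limn_einf (fun j => (f j w)%:E)) = (fun w => (g w)%:E)).
    have E j : (\int[mu]_w (f j w)%:E)%E = (\int[mu]_w f j w)%:E.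
      by rewrite /Rintegral fineK//; exact: (integrable_fin_num measurableT (If j)).
    have cv : (fun j => \int[mu]_w (f j w)%:E)%E @ \oo --> l%:E.
      rewrite (_ : (fun j => _) = EFin \o (fun j => \int[mu]_w f j w)).
        by apply: cvg_EFin; [exact: nearW|exact: fl].
      by apply/funext => j; rewrite E.
    rewrite (cvg_limn_einf_sup cv); apply.
      by move=> j; apply/measurable_EFinP; exact: measurable_rintegrable (If j).
    by move=> j w _; rewrite lee_fin.
  apply/funext => w.
  have cv : (fun j => (f j w)%:E) @ \oo --> (g w)%:E.
    by apply: cvg_EFin; [exact: nearW|exact: fg].
  by rewrite (cvg_limn_einf_sup cv).
have Ig : rintegrable g.
  apply/integrableP; split; first exact/measurable_EFinP.
  under eq_integral do rewrite /= (ger0_norm (g0 _)).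
  by apply: le_lt_trans le _; rewrite ltry.
split => //; rewrite -lee_fin /Rintegral fineK//.
exact: (integrable_fin_num measurableT Ig).
Qed.

End RealIntegrable.
Arguments rintegrable {d T R} mu f.

Section Moments.
Context d (T : measurableType d) (R : realType) (mu : probability T R).
Variables (X : T -> R) (e : nat -> R).
Hypothesis mX : measurable_fun setT X.
Hypothesis entire_e : entire e.
Hypothesis cosE : forall t : R, \int[mu]_w cos (t * X w) =
  limn (series (fun k => e k * (- t ^+ 2) ^+ k)).
Hypothesis sinE : forall t : R, \int[mu]_w sin (t * X w) = 0.

Let measurable_scaled (f : R -> R) (t : R) : measurable_fun setT f ->
  measurable_fun setT (fun w => f (t * X w)).
Proof. by move=> mf; apply: measurableT_comp => //; exact: measurable_funM. Qed.

Lemma rintegrable_bounded (f : T -> R) (M : R) : measurable_fun setT f ->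
  (forall w, `|f w| <= M) -> rintegrable mu f.
Proof.
move=> mf fM; apply: (rintegrable_le mf fM).
by apply: finite_measure_integrable_cst.
Qed.

Let has_even_moment (k : nat) : Prop :=
  rintegrable mu (fun w => X w ^+ k.*2) /\ \int[mu]_w (X w ^+ k.*2) = k.*2`!%:R * e k.

(** Taylor expansion of the characteristic function, integrated termwise. *)
Let cos_rem_integral n (h : R) : (forall k, (k < n)%N -> has_even_moment k) ->
  rintegrable mu (fun w => cos_rem n (h * X w)) /\
  \int[mu]_w cos_rem n (h * X w) = (-1) ^+ n *
    (limn (series (fun k => e k * (- h ^+ 2) ^+ k)) - \sum_(k < n) e k * (- h ^+ 2) ^+ k).
Proof.
elim: n => [|n IH] H.
  split; last by rewrite big_ord0 subr0 expr0 mul1r /=; exact: cosE.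
  apply: (@rintegrable_bounded _ 1); last by move=> w; exact: cos_max.
  by apply: (@measurable_scaled (cos_rem 0)); exact: measurable_cos_rem.
have [IHi IHv] := IH (fun k kn => H k (leqW kn)).
have [Xi Xv] := H n (leqnn _).
have E w : cos_rem n.+1 (h * X w) =
    h ^+ n.*2 / n.*2`!%:R * X w ^+ n.*2 - cos_rem n (h * X w).
  by rewrite /= exprMn mulrAC.
have I1 := rintegrableZ (h ^+ n.*2 / n.*2`!%:R) Xi.
split.
  have := rintegrableB I1 IHi; congr (rintegrable mu _).
  by apply/funext => w; rewrite E.
under eq_Rintegral do rewrite E.
rewrite RintegralB// RintegralZl// Xv IHv big_ord_recr /=.
have f0 : n.*2`!%:R != 0 :> R by rewrite pnatr_eq0 -lt0n fact_gt0.
have s1 : (-1) ^+ n * (-1) ^+ n = 1 :> R by rewrite -exprMn mulrNN mulr1 expr1n.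
have -> : (- h ^+ 2) ^+ n = (-1) ^+ n * h ^+ n.*2.
  by rewrite [LHS]exprNn -exprM mul2n.
rewrite mulrA divfK// [(-1) ^+ n.+1]exprS.
move: s1; move: ((-1) ^+ n) (h ^+ n.*2) (limn _) (\sum_(_ < _) _) => s x L S s1.
transitivity (s * s * (x * e n) - s * (L - S)); last by ring.
by rewrite s1 mul1r.
Qed.

Let even_moment0 : has_even_moment 0.
Proof.
(* At [t = 0] the characteristic function is 1 and the series reduces to [e 0]. *)
have e0 : e 0 = 1.
  have := @entire_tail_le R e (fun k => (- 0 ^+ 2) ^+ k) 0 1 entire_e.
  have -> : (0 <= (0 : R) <= 1) by rewrite lexx ler01.
  move=> /(_ isT); rewrite -cosE big_ord1 expr1 mul0r expr0 mulr1 => H0.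
  have {}H0 : `|\int[mu]_w cos (0 * X w) - e 0| <= 0.
    by apply: H0 => k; rewrite expr0n oppr0 normrX normr0.
  move: H0; rewrite normr_le0 subr_eq0 => /eqP <-.
  under eq_Rintegral do rewrite mul0r cos0.
  by rewrite Rintegral_cst// mul1r; exact: (congr1 fine (probability_setT mu)).
split.
  apply: (@rintegrable_bounded _ 1); first exact: measurable_funX.
  by move=> w; rewrite expr0 normr1.
under eq_Rintegral do rewrite expr0.
by rewrite Rintegral_cst// mul1r fact0 mul1r e0; exact: (congr1 fine (probability_setT mu)).
Qed.

Section EvenMomentStep.
Variable n : nat.
Notation N := n.+1.
Notation F := (N.*2`!%:R : R).

(** As [h] goes to 0 this tends to [X ^ 2N / (2N)!] from below. *)
Let cos_quot (h : R) (w : T) : R := cos_rem N (h * X w) / h ^+ N.*2.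

Let F_gt0 : 0 < F. Proof. by rewrite ltr0n fact_gt0. Qed.

Let X_ge0 k w : 0 <= X w ^+ k.*2 / k.*2`!%:R.
Proof. by rewrite divr_ge0// exprn_even_ge0//= odd_double. Qed.

Let cos_quot_ge0 h w : 0 < h -> 0 <= cos_quot h w.
Proof. by move=> h0; rewrite divr_ge0 ?cos_rem_ge0// exprn_ge0// ltW. Qed.

Let cos_quot_le h w : 0 < h -> cos_quot h w <= X w ^+ N.*2 / F.
Proof.
move=> h0; rewrite ler_pdivrMr ?exprn_gt0// mulrAC -exprMn [X w * _]mulrC.
exact: cos_rem_le.
Qed.

Let cos_quot_dist h w : 0 < h ->
  `|cos_quot h w - X w ^+ N.*2 / F| <= X w ^+ N.+1.*2 / N.+1.*2`!%:R * h ^+ 2.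
Proof.
move=> h0; have hN0 : 0 < h ^+ N.*2 by rewrite exprn_gt0.
have -> : cos_quot h w - X w ^+ N.*2 / F =
    (cos_rem N (h * X w) - (h * X w) ^+ N.*2 / F) / h ^+ N.*2.
  rewrite /cos_quot exprMn [RHS]mulrBl; congr (_ - _).
  by rewrite [RHS]mulrAC [h ^+ _ * _]mulrC mulfK// gt_eqF.
rewrite normrM normfV (ger0_norm (ltW hN0)) ler_pdivrMr//.
apply: (le_trans (cos_rem_sub_le _ _)).
have -> : (h * X w) ^+ N.+1.*2 = h ^+ 2 * h ^+ N.*2 * X w ^+ N.+1.*2.
  by rewrite exprMn -exprD.
by rewrite -[leLHS]mulrA [leLHS]mulrC mulrA lexx.
Qed.

Let measurable_cos_quot h : measurable_fun setT (cos_quot h).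
Proof.
apply: measurable_funM => //.
by apply: (@measurable_scaled (cos_rem N)); exact: measurable_cos_rem.
Qed.

Hypothesis H : forall k, (k < N)%N -> has_even_moment k.

Let rintegrable_cos_quot h : rintegrable mu (cos_quot h).
Proof.
have [I _] := cos_rem_integral h H.
have := rintegrableZ (h ^+ N.*2)^-1 I; congr (rintegrable mu _).
by apply/funext => w; rewrite mulrC.
Qed.

Let integral_cos_quot h : 0 < h -> h <= 1 ->
  `|\int[mu]_w cos_quot h w - e N| <= majorant e 1 * h ^+ 2.
Proof.
move=> h0 h1; have [I v] := cos_rem_integral h H.
under eq_Rintegral do rewrite /cos_quot mulrC.
rewrite RintegralZl// v.
have hN0 : 0 < h ^+ N.*2 by rewrite exprn_gt0.
have h2 : 0 <= h ^+ 2 <= 1 by rewrite sqr_ge0 exprn_ile1// ltW.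
have wE k : `|(- h ^+ 2) ^+ k| <= (h ^+ 2) ^+ k.
  by rewrite normrX normrN ger0_norm// sqr_ge0.
have := entire_tail_le N.+1 entire_e h2 wE.
have hE : (- h ^+ 2) ^+ N = (-1) ^+ N * h ^+ N.*2.
  by rewrite [LHS]exprNn -exprM mul2n.
have s1 : (-1) ^+ N * (-1) ^+ N = 1 :> R by rewrite -exprMn mulrNN mulr1 expr1n.
rewrite big_ord_recr /= hE => B.
have -> : (h ^+ N.*2)^-1 * ((-1) ^+ N *
    (limn (series (fun k => e k * (- h ^+ 2) ^+ k)) -
     \sum_(k < N) e k * (- h ^+ 2) ^+ k)) - e N =
  (h ^+ N.*2)^-1 * ((-1) ^+ N *
    (limn (series (fun k => e k * (- h ^+ 2) ^+ k)) -
     (\sum_(k < N) e k * (- h ^+ 2) ^+ k + e N * ((-1) ^+ N * h ^+ N.*2)))).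
  have := lt0r_neq0 hN0.
  move: s1; move: ((-1) ^+ N) (h ^+ N.*2) (limn _) (\sum_(_ < _) _) => s x L S s1 x0.
  transitivity (x^-1 * (s * (L - S) - s * s * (e N * x))); last by congr (_ * _); ring.
  by rewrite s1 mul1r [RHS]mulrBr [_^-1 * (e N * _)]mulrCA mulVf ?mulr1.
rewrite !normrM normrX normrN1 expr1n mul1r normfV (ger0_norm (ltW hN0)).
rewrite mulrC ler_pdivrMr//; apply: (le_trans B).
by rewrite exprS -[(h ^+ 2) ^+ N]exprM mul2n mulrC mulrA.
Qed.

Let h_ (j : nat) : R := harmonic j.

Let h_gt0 j : 0 < h_ j. Proof. exact: harmonic_gt0. Qed.

Let h_le1 j : h_ j <= 1.
Proof. by rewrite /h_ /= invf_le1 ?ltr0n// ler1n. Qed.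

Let cvg_dist_h (u : nat -> R) (l M : R) :
  (forall j, `|u j - l| <= M * h_ j ^+ 2) -> u @ \oo --> l.
Proof.
move=> B; apply/subr_cvg0/norm_cvg0P.
apply: (@squeeze_cvgr _ _ _ _ (fun=> 0) (fun j => M * h_ j ^+ 2)).
- by apply: nearW => j /=; rewrite normr_ge0 /=; exact: B.
- exact: cvg_cst.
- have -> : 0 = M * (0 * 0) :> R by rewrite !mulr0.
  apply: cvgM; first exact: cvg_cst.
  by apply: cvgM; exact: cvg_harmonic.
Qed.

Let cvg_cos_quot w : (fun j => cos_quot (h_ j) w) @ \oo --> X w ^+ N.*2 / F.
Proof. by apply: cvg_dist_h => j; exact: cos_quot_dist. Qed.

Let cvg_integral_cos_quot : (fun j => \int[mu]_w cos_quot (h_ j) w) @ \oo --> e N.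
Proof. by apply: cvg_dist_h => j; exact: integral_cos_quot. Qed.

Let measurable_XN : measurable_fun setT (fun w => X w ^+ N.*2 / F).
Proof. by apply: measurable_funM => //; exact: measurable_funX. Qed.

(** Fatou's lemma gives the integrability and one inequality; the other one holds
    because [cos_quot] stays below its limit. *)
Lemma even_momentS : has_even_moment N.
Proof.
have [IX leX] : rintegrable mu (fun w => X w ^+ N.*2 / F) /\
    \int[mu]_w (X w ^+ N.*2 / F) <= e N.
  apply: (fatou_cvg (f := fun j => cos_quot (h_ j))) => //.
  by move=> j w; exact: cos_quot_ge0.
have vX : \int[mu]_w (X w ^+ N.*2 / F) = e N.
  apply/eqP; rewrite eq_le leX /=.
  apply: (cvgr_to_le cvg_integral_cos_quot); apply: nearW => j.
  apply: le_Rintegral => //; first exact: rintegrable_cos_quot.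
  by move=> w _; exact: cos_quot_le.
have XE w : X w ^+ N.*2 = F * (X w ^+ N.*2 / F) by rewrite mulrCA divff ?mulr1// gt_eqF.
split.
  have := rintegrableZ F IX; congr (rintegrable mu _).
  by apply/funext => w; rewrite -XE.
by under eq_Rintegral do rewrite XE; rewrite RintegralZl// vX.
Qed.

End EvenMomentStep.

Lemma even_moment n : has_even_moment n.
Proof.
elim/ltn_ind: n => -[_|n IH]; first exact: even_moment0.
exact: even_momentS.
Qed.

(** Odd powers lie below the sum of the two neighbouring even powers. *)
Lemma moment_rintegrable n : rintegrable mu (fun w => X w ^+ n).
Proof.
rewrite -(odd_double_half n); case: (odd n); last by case: (even_moment n./2).
have [I0 _] := even_moment n./2; have [I1 _] := even_moment n./2.+1.
apply: (rintegrable_le _ _ (rintegrableD I0 I1)); first exact: measurable_funX.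
move=> w; rewrite add1n -[n./2.+1.*2]/(n./2.*2.+2) !exprS mulrA -expr2 normrM.
set y := X w ^+ _; have y0 : 0 <= y by rewrite exprn_even_ge0//= odd_double.
rewrite (ger0_norm y0) -[X in _ <= X + _]mul1r -mulrDl ler_wpM2r//.
rewrite -real_normK ?num_real//.
have : 0 <= (`|X w| - 1) ^+ 2 by exact: sqr_ge0.
have : 0 <= `|X w| by [].
by nra.
Qed.

Let sin_rem_integral n (h : R) : (forall k, (k < n)%N -> \int[mu]_w (X w ^+ k.*2.+1) = 0) ->
  rintegrable mu (fun w => sin_rem n (h * X w)) /\ \int[mu]_w sin_rem n (h * X w) = 0.
Proof.
elim: n => [|n IH] H.
  split; last exact: sinE.
  apply: (@rintegrable_bounded _ 1); last by move=> w; exact: sin_max.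
  by apply: (@measurable_scaled (sin_rem 0)); exact: measurable_sin_rem.
have [IHi IHv] := IH (fun k kn => H k (leqW kn)).
have E w : sin_rem n.+1 (h * X w) =
    h ^+ n.*2.+1 / n.*2.+1`!%:R * X w ^+ n.*2.+1 - sin_rem n (h * X w).
  by rewrite [LHS]/= exprMn mulrAC.
have I1 := rintegrableZ (h ^+ n.*2.+1 / n.*2.+1`!%:R) (moment_rintegrable n.*2.+1).
split.
  have := rintegrableB I1 IHi; congr (rintegrable mu _).
  by apply/funext => w; rewrite E.
under eq_Rintegral do rewrite E.
rewrite RintegralB// RintegralZl//; last exact: moment_rintegrable.
by rewrite IHv H// mulr0 subrr.
Qed.

(** Once the lower odd moments vanish, the integral of [sin_rem n.+1 (h X)] reduces
    to [h ^ (2n+1)] times the moment sought. It is also [O(h ^ (2n+3))], hence the moment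
    is 0. *)
Lemma odd_moment n : \int[mu]_w (X w ^+ n.*2.+1) = 0.
Proof.
elim/ltn_ind: n => n IH; set m := Rintegral _ _ _.
set F : R := n.*2.+1`!%:R.
have F0 : 0 < F by rewrite ltr0n fact_gt0.
pose M : R := (\int[mu]_w `|X w ^+ n.+1.*2.+1|) / n.+1.*2.+1`!%:R.
have IX : rintegrable mu (fun w => `|X w ^+ n.+1.*2.+1|).
  exact: (integrable_norm (moment_rintegrable n.+1.*2.+1)).
have B h : 0 < h -> `|m| / F <= M * h ^+ 2.
  move=> h0; have hN0 : 0 < h ^+ n.*2.+1 by rewrite exprn_gt0.
  have [I0 v0] := sin_rem_integral h IH.
  have I1 := rintegrableZ (h ^+ n.*2.+1 / F) (moment_rintegrable n.*2.+1).
  have E w : sin_rem n.+1 (h * X w) =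
      h ^+ n.*2.+1 / F * X w ^+ n.*2.+1 - sin_rem n (h * X w).
    by rewrite [LHS]/= exprMn mulrAC.
  have I2 : rintegrable mu (fun w => sin_rem n.+1 (h * X w)).
    have := rintegrableB I1 I0; congr (rintegrable mu _).
    by apply/funext => w; rewrite E.
  have v2 : \int[mu]_w sin_rem n.+1 (h * X w) = h ^+ n.*2.+1 / F * m.
    under eq_Rintegral do rewrite E.
    rewrite RintegralB// RintegralZl//; last exact: moment_rintegrable.
    by rewrite v0 subr0.
  have c0 : 0 <= h ^+ n.+1.*2.+1 / n.+1.*2.+1`!%:R.
    by rewrite divr_ge0// exprn_ge0// ltW.
  have : `|h ^+ n.*2.+1 / F * m| <= h ^+ n.+1.*2.+1 / n.+1.*2.+1`!%:R * \int[mu]_w `|X w ^+ n.+1.*2.+1|.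
    rewrite -v2 -RintegralZl//.
    apply: (le_trans (le_normr_Rintegral measurableT I2)).
    apply: le_Rintegral => //.
    - exact: (integrable_norm I2).
    - exact: rintegrableZ.
    move=> w _; apply: (le_trans (sin_rem_le _ _)).
    by rewrite normrM exprMn (ger0_norm (ltW h0)) normrX mulrAC.
  rewrite !normrM normfV (ger0_norm (ltW F0)) (ger0_norm (ltW hN0)) => B.
  rewrite -(ler_pM2l hN0) mulrCA [`|m| * _]mulrC; apply: (le_trans B).
  have -> : h ^+ n.+1.*2.+1 = h ^+ 2 * h ^+ n.*2.+1 by rewrite -exprD.
  rewrite /M; move: (h ^+ 2) (h ^+ _) (Rintegral _ _ _) (_%:R) => p q J f.
  by rewrite le_eqVlt; apply/orP; left; apply/eqP; ring.
have : `|m| / F <= 0.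
  apply: (@le0_of_harmonic _ _ M) => j; apply: (le_trans (B (harmonic j) (harmonic_gt0 _))).
  rewrite ler_wpM2l//.
    by rewrite divr_ge0// Rintegral_ge0.
  rewrite expr2 -[leRHS]mulr1 ler_wpM2l// ?harmonic_ge0//.
  by rewrite /harmonic /= invf_le1 ?ltr0n// ler1n.
by rewrite pmulr_lle0 ?invr_gt0// normr_le0 => /eqP.
Qed.

Lemma moment n : \int[mu]_w (X w ^+ n) = if odd n then 0 else n`!%:R * e n./2.
Proof.
rewrite -{1}(odd_double_half n); case: ifP => o; first exact: odd_moment.
rewrite -{2}(odd_double_half n) o add0n.
by case: (even_moment n./2).
Qed.

End Moments.

(** * The complex exponential as a power series *)

Section ExponentialSeries.
Context {F : numFieldType}.

Definition exp_sum (z : F) (N : nat) : F := \sum_(n < N) z ^+ n / n`!%:R.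

Lemma sum_triangle (G : nat -> nat -> F) N :
  \sum_(n < N) \sum_(j < n.+1) G (n - j)%N j = \sum_(j < N) \sum_(k < N - j) G k j.
Proof.
elim: N => [|N IH]; first by rewrite !big_ord0.
rewrite big_ord_recr /= IH [in RHS]big_ord_recr /= subSnn big_ord1.
rewrite [X in _ + X = _]big_ord_recr /= subnn addrA; congr (_ + _).
rewrite -big_split /=; apply: eq_bigr => j _.
by rewrite subSn ?(ltnW (ltn_ord j))// big_ord_recr.
Qed.

Lemma expr_div_fact (a b : F) n : (a + b) ^+ n / n`!%:R =
  \sum_(j < n.+1) (a ^+ (n - j) / (n - j)`!%:R) * (b ^+ j / j`!%:R).
Proof.
rewrite exprDn mulr_suml; apply: eq_bigr => j _.
have jn : (j <= n)%N by rewrite -ltnS.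
have c0 : 'C(n, j)%:R != 0 :> F by rewrite pnatr_eq0 -lt0n bin_gt0.
have f0 k : k`!%:R != 0 :> F by rewrite pnatr_eq0 -lt0n fact_gt0.
have -> : n`!%:R = 'C(n, j)%:R * (j`!%:R * (n - j)`!%:R) :> F.
  by rewrite -!natrM bin_fact.
rewrite -mulr_natl; move: (f0 j) (f0 (n - j)%N) c0.
move: (j`!%:R) ((n - j)`!%:R) ('C(n, j)%:R) (a ^+ _) (b ^+ _) => x y z u v x0 y0 z0.
by field; rewrite x0 y0 z0.
Qed.

(** The square of indices [j, k < N] minus the triangle [j + k < N]. *)
Lemma exp_sumM_sub (a b : F) N : exp_sum a N * exp_sum b N - exp_sum (a + b) N =
  \sum_(j < N) \sum_(N - j <= k < N) (a ^+ j / j`!%:R) * (b ^+ k / k`!%:R).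
Proof.
have -> : exp_sum (a + b) N = \sum_(n < N) \sum_(j < n.+1)
    (b ^+ (n - j) / (n - j)`!%:R) * (a ^+ j / j`!%:R).
  by apply: eq_bigr => n _; rewrite addrC expr_div_fact.
rewrite /exp_sum.
rewrite (sum_triangle (fun k j => (b ^+ k / k`!%:R) * (a ^+ j / j`!%:R))).
rewrite mulr_suml -sumrB; apply: eq_bigr => j _.
rewrite mulr_sumr -(big_mkord xpredT (fun k => a ^+ j / j`!%:R * (b ^+ k / k`!%:R))).
rewrite -(big_mkord xpredT (fun k => b ^+ k / k`!%:R * (a ^+ j / j`!%:R))).
rewrite (big_cat_nat (n := N - j)) ?leq_subr//= addrAC.
under [X in _ - X + _]eq_bigr do rewrite mulrC.
by rewrite subrr add0r.
Qed.

End ExponentialSeries.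

Section ComplexExponential.
Context {R : realType}.

Lemma cvg_exp_sum (x : R) : exp_sum x @ \oo --> expR x.
Proof.
have := @is_cvg_series_exp_coeff R x; rewrite -/(expR x) => H.
rewrite (_ : exp_sum x = series (exp_coeff x)); first exact: H.
by apply/funext => n; rewrite seriesEord.
Qed.

Lemma expi n : 'i ^+ n =
  ((~~ odd n)%:R * (-1) ^+ n./2) +i* ((odd n)%:R * (-1) ^+ n.-1./2) :> R[i].
Proof.
have i2 k : ('i : R[i]) ^+ k.*2 = ((-1) ^+ k)%:C.
  by rewrite -mul2n exprM sqr_i rmorphXn rmorphN1.
rewrite -{1}(odd_double_half n) exprD i2; case: (boolP (odd n)) => o /=.
  rewrite expr1 mul0r mul1r mulrC.
  have -> : n.-1./2 = n./2 by rewrite -[in LHS](odd_double_half n) o /= doubleK.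
  by apply/eqP; rewrite eq_complex /= !mul0r !mulr0 mulr1 addr0 subr0 !eqxx.
by rewrite expr0 !mul1r mul0r.
Qed.

Lemma expi_term (y : R) n :
  ('i * y%:C) ^+ n / n`!%:R = cos_coeff y n +i* sin_coeff y n.
Proof.
have -> : ('i * y%:C) ^+ n / n`!%:R = (y ^+ n / n`!%:R)%:C * 'i ^+ n.
  by rewrite exprMn -mulrA mulrC rmorphM fmorphV rmorphXn rmorph_nat.
rewrite expi; apply/eqP; rewrite eq_complex Re_realM Im_realM /cos_coeff /sin_coeff /=.
by apply/andP; split; apply/eqP; rewrite mulrC mulrA.
Qed.

Lemma exp_sum_real (x : R) N : exp_sum x%:C N = (exp_sum x N)%:C.
Proof.
rewrite /exp_sum rmorph_sum; apply: eq_bigr => n _ /=.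
by rewrite rmorphM fmorphV rmorphXn rmorph_nat.
Qed.

Lemma exp_sum_i (y : R) N :
  exp_sum ('i * y%:C) N = series (cos_coeff y) N +i* series (sin_coeff y) N.
Proof.
rewrite /exp_sum; under eq_bigr do rewrite expi_term.
by apply/eqP; rewrite eq_complex !seriesEord Re_sum Im_sum /= !eqxx.
Qed.

Lemma normc_sum I (s : seq I) (F : I -> R[i]) :
  normc (\sum_(i <- s) F i) <= \sum_(i <- s) normc (F i).
Proof.
elim: s => [|i s IH]; first by rewrite !big_nil normc0.
by rewrite !big_cons (le_trans (le_normcD _ _))// lerD2l.
Qed.

Lemma normc_expr_div_fact (z : R[i]) n : normc (z ^+ n / n`!%:R) = normc z ^+ n / n`!%:R.
Proof.
have -> : z ^+ n / n`!%:R = z ^+ n * (n`!%:R^-1)%:C by rewrite fmorphV rmorph_nat.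
by rewrite normcM normcX normc_real ger0_norm// invr_ge0.
Qed.

(** The defect of multiplicativity of the partial sums is a sum of terms with
    nonnegative coefficients, hence is dominated by the defect for positive reals. *)
Lemma exp_sum_defect (a b : R[i]) N :
  normc (exp_sum a N * exp_sum b N - exp_sum (a + b) N) <=
  exp_sum (normc a) N * exp_sum (normc b) N - exp_sum (normc a + normc b) N.
Proof.
rewrite !exp_sumM_sub (le_trans (normc_sum _ _))//; apply: ler_sum => j _.
rewrite (le_trans (normc_sum _ _))//; apply: ler_sum => k _.
by rewrite normcM !normc_expr_div_fact.
Qed.

Lemma cvg_exp_sum_defect (a b : R[i]) :
  normc (exp_sum a N * exp_sum b N - exp_sum (a + b) N) @[N --> \oo] --> 0.
Proof.
apply: (@squeeze_cvgr _ _ _ _ (fun=> 0) (fun N => exp_sum (normc a) N * exp_sum (normc b) N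
   - exp_sum (normc a + normc b) N)).
- by apply: nearW => N; rewrite normc_ge0 exp_sum_defect.
- exact: cvg_cst.
- rewrite -[0](subrr (expR (normc a + normc b))) {1}expRD.
  by apply: cvgB; [apply: cvgM|]; exact: cvg_exp_sum.
Qed.

(** For [z = x + i y] the partial sums of [exp x] and [exp (i y)] converge by the real
    theory, and those of [exp z] differ from their product by the vanishing defect. *)
Lemma cvg_exp_sum_complex (z : R[i]) :
  complex.Re (exp_sum z N) @[N --> \oo] --> complex.Re (expC z) /\
  complex.Im (exp_sum z N) @[N --> \oo] --> complex.Im (expC z).
Proof.
case: z => x y; pose D N := exp_sum x%:C N * exp_sum ('i * y%:C) N - exp_sum (x +i* y) N.
have D0 : normc (D N) @[N --> \oo] --> 0.
  have := cvg_exp_sum_defect x%:C ('i * y%:C).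
  by rewrite (_ : x%:C + 'i * y%:C = x +i* y)// [RHS]complexE.
have part0 (f : R[i] -> R) : (forall z, `|f z| <= normc z) -> f (D N) @[N --> \oo] --> 0.
  move=> fn; apply/norm_cvg0P.
  apply: (@squeeze_cvgr _ _ _ _ (fun=> 0) (fun N => normc (D N))) => //.
  - by apply: nearW => N /=; rewrite normr_ge0 fn.
  - exact: cvg_cst.
have cx := cvg_exp_sum (x := x).
have cc : series (cos_coeff y) @ \oo --> cos y.
  by rewrite unlock; exact: is_cvg_series_cos_coeff.
have cs : series (sin_coeff y) @ \oo --> sin y.
  by rewrite unlock; exact: is_cvg_series_sin_coeff.
have E N : exp_sum (x +i* y) N = exp_sum x%:C N * exp_sum ('i * y%:C) N - D N.
  by rewrite /D opprB addrC subrK.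
split.
  rewrite (_ : (fun N => _) = (fun N => exp_sum x N * series (cos_coeff y) N -
      complex.Re (D N))).
    rewrite (_ : complex.Re _ = expR x * cos y - 0).
      by apply: cvgB; [exact: cvgM|exact: part0 Re_le_normc].
    by rewrite /expC Re_realM /= subr0.
  by apply/funext => N; rewrite E exp_sum_real exp_sum_i raddfB /= mul0r subr0.
rewrite (_ : (fun N => _) = (fun N => exp_sum x N * series (sin_coeff y) N -
    complex.Im (D N))).
  rewrite (_ : complex.Im _ = expR x * sin y - 0).
    by apply: cvgB; [exact: cvgM|exact: part0 Im_le_normc].
  by rewrite /expC Im_realM /= subr0.
by apply/funext => N; rewrite E exp_sum_real exp_sum_i raddfB /= mul0r addr0.
Qed.

Lemma normc_exp_sum_le (z : R[i]) N : normc (exp_sum z N) <= expR (normc z).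
Proof.
apply: (@le_trans _ _ (exp_sum (normc z) N)).
  rewrite (le_trans (normc_sum _ _))//; apply: ler_sum => n _.
  by rewrite normc_expr_div_fact.
have c := cvg_exp_sum (x := normc z); rewrite -(cvg_lim (@Rhausdorff R) c).
apply: nondecreasing_cvgn_le; last exact: cvgP c.
apply/nondecreasing_seqP => n; rewrite /exp_sum big_ord_recr /= lerDl.
by rewrite divr_ge0// exprn_ge0// normc_ge0.
Qed.

End ComplexExponential.

(** * Exponential moments and the joint Laplace transform *)

Lemma sum_double (V : nmodType) (u : nat -> V) N :
  \sum_(n < N.*2) u n = \sum_(k < N) (u k.*2 + u k.*2.+1).
Proof.
elim: N => [|N IH]; first by rewrite !big_ord0.
by rewrite doubleS !big_ord_recr /= IH addrA.
Qed.

Lemma cvg_double (U : topologicalType) (u : nat -> U) (l : U) :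
  u @ \oo --> l -> (fun n => u n.*2) @ \oo --> l.
Proof.
apply: cvg_comp => P [N _ PN]; exists N => // n /= Nn; apply: PN => /=.
by apply: (leq_trans Nn); rewrite -addnn leq_addr.
Qed.

Section ExponentialMoment.
Context d (T : measurableType d) (R : realType) (mu : probability T R).
Variables (X : T -> R) (e : nat -> R).
Hypothesis mX : measurable_fun setT X.
Hypothesis entire_e : entire e.
Hypothesis cosE : forall t : R, \int[mu]_w cos (t * X w) =
  limn (series (fun k => e k * (- t ^+ 2) ^+ k)).
Hypothesis sinE : forall t : R, \int[mu]_w sin (t * X w) = 0.

(** The series of [exp x + exp (- x)] has only even terms, which are nonnegative,
    and integrating it termwise gives the convergent series [2 * e k]. *)
Lemma rintegrable_exp_norm : rintegrable mu (fun w => expR `|X w|).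
Proof.
pose f N w := \sum_(k < N) 2 * (X w ^+ k.*2 / k.*2`!%:R).
have fE N w : f N w = exp_sum (X w) N.*2 + exp_sum (- X w) N.*2.
  rewrite /exp_sum -big_split /= (sum_double (fun n => X w ^+ n / n`!%:R + (- X w) ^+ n / n`!%:R)).
  apply: eq_bigr => k _; rewrite !exprS -mul2n !exprM sqrrN !mulNr subrr addr0.
  by rewrite mulr2n mulrDl mul1r.
have If N : rintegrable mu (f N).
  apply: (@rintegrable_sum _ _ _ _ _ _ (fun (k : 'I_N) w => 2 * (X w ^+ k.*2 / k.*2`!%:R))) => k.
  apply: rintegrableZ; have := rintegrableZ (k.*2`!%:R^-1) (moment_rintegrable mX entire_e cosE k.*2).
  by congr (rintegrable mu _); apply/funext => w; rewrite mulrC.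
have [Icosh _] : rintegrable mu (fun w => expR (X w) + expR (- X w)) /\
    \int[mu]_w (expR (X w) + expR (- X w)) <= 2 * limn (series (fun k => e k * 1)).
  apply: (fatou_cvg If).
  - move=> N w; apply: sumr_ge0 => k _; rewrite mulr_ge0// divr_ge0//.
    by rewrite exprn_even_ge0//= odd_double.
  - by apply: measurable_funD; apply: measurableT_comp => //; exact: measurableT_comp.
  - move=> w; rewrite (_ : f ^~ w = fun N => exp_sum (X w) N.*2 + exp_sum (- X w) N.*2).
      by apply: cvgD; apply: cvg_double; exact: cvg_exp_sum.
    by apply/funext => N; exact: fE.
  rewrite (_ : (fun N => _) = (fun N => 2 * series (fun k => e k * 1) N)).
    apply: cvgM; first exact: cvg_cst.
    apply: (cvg_series_entire (A := 1) (r := 1)) => // k.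
    by rewrite normr1 expr1n mulr1.
  apply/funext => N; rewrite seriesEord mulr_sumr.
  rewrite (@Rintegral_sum _ _ _ _ _ _ (fun (k : 'I_N) w => 2 * (X w ^+ k.*2 / k.*2`!%:R))); last first.
    move=> k; apply: rintegrableZ.
    have := rintegrableZ (k.*2`!%:R^-1) (moment_rintegrable mX entire_e cosE k.*2).
    by congr (rintegrable mu _); apply/funext => w; rewrite mulrC.
  apply: eq_bigr => k _.
  under eq_Rintegral do rewrite mulrA mulrAC.
  rewrite RintegralZl//; last exact: moment_rintegrable cosE _.
  rewrite (moment mX entire_e cosE sinE) odd_double doubleK.
  have f0 : k.*2`!%:R != 0 :> R by rewrite pnatr_eq0 -lt0n fact_gt0.
  by rewrite mulr1 mulrA divfK.
apply: (rintegrable_le _ _ Icosh).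
  by apply: measurableT_comp => //; exact: measurableT_comp.
move=> w; rewrite ger0_norm ?expR_ge0//.
have [x0|x0] := leP 0 (X w).
  by rewrite ger0_norm// lerDl expR_ge0.
by rewrite ltr0_norm// lerDr expR_ge0.
Qed.

End ExponentialMoment.

Lemma poly_eq_of_horner (R : realType) (p q : {poly R}) :
  (forall v : R, p.[v] = q.[v]) -> p = q.
Proof.
move=> pq; apply/eqP; rewrite -subr_eq0; apply/eqP.
pose rs : seq R := [seq i%:R | i <- iota 0 (size (p - q)).+1].
apply: (@roots_geq_poly_eq0 _ _ rs).
- by apply/allP => x _; rewrite rootE hornerD hornerN pq subrr.
- by rewrite map_inj_uniq ?iota_uniq// => i j /eqP; rewrite eqr_nat => /eqP.
- by rewrite size_map size_iota.
Qed.

Section JointLaplace.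
Context d (T : measurableType d) (R : realType) (mu : probability T R).
Variables (X Y : T -> R) (c : nat -> R) (A B C : R).
Hypotheses (mX : measurable_fun setT X) (mY : measurable_fun setT Y).
Hypothesis entire_c : entire c.

(** Half of the quadratic form at [u * X + v * Y]. *)
Let q (u v : R) : R := (u ^+ 2 * A + 2 * (u * v) * B + v ^+ 2 * C) / 2.

Hypothesis cosE : forall u v t : R, \int[mu]_w cos (t * (u * X w + v * Y w)) =
  limn (series (fun k => c k * q u v ^+ k * (- t ^+ 2) ^+ k)).
Hypothesis sinE : forall u v t : R, \int[mu]_w sin (t * (u * X w + v * Y w)) = 0.

Let measurable_comb u v : measurable_fun setT (fun w => u * X w + v * Y w).
Proof. by apply: measurable_funD; exact: measurable_funM. Qed.

Let comb_rintegrable u v n : rintegrable mu (fun w => (u * X w + v * Y w) ^+ n).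
Proof.
exact: (moment_rintegrable (measurable_comb u v) (entire_scale (x := q u v) entire_c) (cosE u v)).
Qed.

Let comb_moment u v n : \int[mu]_w ((u * X w + v * Y w) ^+ n) =
  if odd n then 0 else n`!%:R * (c n./2 * q u v ^+ n./2).
Proof.
exact: (moment (measurable_comb u v) (entire_scale (x := q u v) entire_c) (cosE u v) (sinE u v)).
Qed.

Let exp_comb u v : rintegrable mu (fun w => expR `|u * X w + v * Y w|).
Proof.
exact: (rintegrable_exp_norm (measurable_comb u v) (entire_scale (x := q u v) entire_c)
  (cosE u v) (sinE u v)).
Qed.

(** [exp (|x| + |y|)] is at most [exp (2 |x|) + exp (2 |y|)]. *)
Lemma rintegrable_exp_norm2 : rintegrable mu (fun w => expR (`|X w| + `|Y w|)).
Proof.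
apply: (rintegrable_le _ _ (rintegrableD (exp_comb 2 0) (exp_comb 0 2))).
  by apply: measurableT_comp => //; apply: measurable_funD; exact: measurableT_comp.
move=> w; rewrite ger0_norm ?expR_ge0// !mul0r addr0 add0r !normrM.
rewrite (ger0_norm (_ : 0 <= 2)) // !mulr2n !mulrDl !mul1r !expRD.
set x := expR _; set y := expR _.
have : 0 <= (x - y) ^+ 2 by exact: sqr_ge0.
have : 0 <= x by exact: expR_ge0.
have : 0 <= y by exact: expR_ge0.
by nra.
Qed.

Lemma mixed_rintegrable i j : rintegrable mu (fun w => X w ^+ i * Y w ^+ j).
Proof.
have IX := comb_rintegrable 1 0 i.*2; have IY := comb_rintegrable 0 1 j.*2.
apply: (rintegrable_le _ _ (rintegrableD IX IY)).
  by apply: measurable_funM; exact: measurable_funX.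
move=> w; rewrite !mul0r !mul1r addr0 add0r -!mul2n ![(2 * _)%N]mulnC !exprM.
rewrite normrM -[X w ^+ i ^+ 2]real_normK ?num_real// -[Y w ^+ j ^+ 2]real_normK ?num_real//.
set x := `|_|; set y := `|_|.
have : 0 <= (x - y) ^+ 2 by exact: sqr_ge0.
have : 0 <= x by exact: normr_ge0.
have : 0 <= y by exact: normr_ge0.
by nra.
Qed.

(** Two expressions of the moments of [X + v * Y] as polynomials in [v]: by the
    binomial expansion, and by the values known from the characteristic functions. *)
Let mixed_poly n : {poly R} :=
  \sum_(j < n.+1) ('C(n, j)%:R * \int[mu]_w (X w ^+ (n - j) * Y w ^+ j)) *: 'X^j.

Let moment_poly n : {poly R} :=
  if odd n then 0 else
  (n`!%:R * c n./2) *: ((A / 2)%:P + B *: 'X + (C / 2) *: 'X^2) ^+ n./2.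

Let mixed_polyE n : mixed_poly n = moment_poly n.
Proof.
apply: poly_eq_of_horner => v.
transitivity (\int[mu]_w ((1 * X w + v * Y w) ^+ n)).
  pose F (j : 'I_n.+1) w := ('C(n, j)%:R * v ^+ j) * (X w ^+ (n - j) * Y w ^+ j).
  have E w : (1 * X w + v * Y w) ^+ n = \sum_(j < n.+1) F j w.
    rewrite mul1r exprDn; apply: eq_bigr => j _; rewrite /F exprMn -mulr_natl.
    by rewrite -!mulrA; congr (_ * _); rewrite mulrCA.
  under eq_Rintegral do rewrite E.
  rewrite Rintegral_sum; last by move=> j; apply: rintegrableZ; exact: mixed_rintegrable.
  rewrite horner_sum; apply: eq_bigr => j _.
  rewrite RintegralZl//; last exact: mixed_rintegrable.
  by rewrite hornerZ hornerXn mulrAC.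
rewrite comb_moment /moment_poly; case: ifP => _; first by rewrite horner0.
rewrite hornerZ horner_exp !hornerD !hornerZ hornerC hornerX hornerXn mulrA.
by congr (_ * _ ^+ _); rewrite /q; field.
Qed.

Let zeta : R[i] := ((A - C) / 2) +i* B.

(** Evaluation at [v = i], where the quadratic form takes the value [2 * zeta]. *)
Let mixed_poly_i n : \sum_(j < n.+1)
    ('C(n, j)%:R * \int[mu]_w (X w ^+ (n - j) * Y w ^+ j))%:C * 'i ^+ j =
  if odd n then 0 else (n`!%:R * c n./2)%:C * zeta ^+ n./2.
Proof.
have := congr1 (fun p => (map_poly (real_complex R) p).['i]) (mixed_polyE n).
rewrite /mixed_poly rmorph_sum horner_sum.
under eq_bigr do rewrite /= map_polyZ map_polyXn hornerZ hornerXn.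
move=> ->; rewrite /moment_poly; case: ifP => _; first by rewrite rmorph0 horner0.
rewrite map_polyZ hornerZ rmorphXn horner_exp; congr (_ * _ ^+ _).
rewrite !rmorphD /= !map_polyZ map_polyC map_polyX map_polyXn !hornerD !hornerZ.
rewrite hornerC hornerX hornerXn sqr_i /zeta.
apply/eqP; rewrite eq_complex /=; apply/andP; split; apply/eqP; first by field.
by field.
Qed.

Section Part.
(** Either of the real-linear maps [Re] and [Im]. *)
Variable f : R[i] -> R.
Hypothesis fD : forall z z', f (z + z') = f z + f z'.
Hypothesis fM : forall x z, f (x%:C * z) = x * f z.
Hypothesis f_le : forall z, `|f z| <= normc z.
Hypothesis f_exp : forall z, f (exp_sum z N) @[N --> \oo] --> f (expC z).
Hypothesis mf : measurable_fun setT (fun w => f (expC (X w +i* Y w))).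

Let f0 : f 0 = 0.
Proof. by rewrite -[0]/(0%:C) -[X in f X](mulr0 0%:C) fM mul0r. Qed.

Let f_sum I (s : seq I) (F : I -> R[i]) : f (\sum_(i <- s) F i) = \sum_(i <- s) f (F i).
Proof. exact: (big_morph f fD f0). Qed.

Let Z w : R[i] := X w +i* Y w.

Let power_part n w : f (Z w ^+ n) =
  \sum_(j < n.+1) ('C(n, j)%:R * f ('i ^+ j)) * (X w ^+ (n - j) * Y w ^+ j).
Proof.
rewrite /Z [_ +i* _]complexE /= exprDn f_sum; apply: eq_bigr => j _.
rewrite exprMn -mulr_natl -!rmorphXn -(rmorph_nat (real_complex R)).
rewrite [_ * (Y w ^+ j)%:C]mulrC !mulrA -!rmorphM fM /=.
by rewrite -!mulrA; congr (_ * _); rewrite [RHS]mulrC mulrA.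
Qed.

Let power_rintegrable n : rintegrable mu (fun w => f (Z w ^+ n)).
Proof.
rewrite (_ : (fun w => _) = (fun w => \sum_(j < n.+1) ('C(n, j)%:R * f ('i ^+ j)) *
    (X w ^+ (n - j) * Y w ^+ j))); last by apply/funext => w; exact: power_part.
apply: (@rintegrable_sum _ _ _ _ _ _ (fun (j : 'I_n.+1) w => ('C(n, j)%:R * f ('i ^+ j)) *
    (X w ^+ (n - j) * Y w ^+ j))) => j.
by apply: rintegrableZ; exact: mixed_rintegrable.
Qed.

Let power_integral n : \int[mu]_w f (Z w ^+ n) =
  if odd n then 0 else n`!%:R * (c n./2 * f (zeta ^+ n./2)).
Proof.
under eq_Rintegral do rewrite power_part.
rewrite (@Rintegral_sum _ _ _ _ _ _ (fun (j : 'I_n.+1) w => ('C(n, j)%:R * f ('i ^+ j)) *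
    (X w ^+ (n - j) * Y w ^+ j))); last first.
  by move=> j; apply: rintegrableZ; exact: mixed_rintegrable.
transitivity (f (\sum_(j < n.+1)
    ('C(n, j)%:R * \int[mu]_w (X w ^+ (n - j) * Y w ^+ j))%:C * 'i ^+ j)).
  rewrite f_sum; apply: eq_bigr => j _; rewrite fM RintegralZl//.
    by rewrite mulrAC.
  exact: mixed_rintegrable.
by rewrite mixed_poly_i; case: ifP => _; rewrite ?f0// fM mulrA.
Qed.

Let f_div_fact z n : f (z / n`!%:R) = n`!%:R^-1 * f z.
Proof. by rewrite mulrC -fM fmorphV rmorph_nat. Qed.

Let f_exp_sum N w : f (exp_sum (Z w) N) = \sum_(n < N) n`!%:R^-1 * f (Z w ^+ n).
Proof. by rewrite f_sum; apply: eq_bigr => n _; rewrite f_div_fact. Qed.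

Let exp_sum_rintegrable N : rintegrable mu (fun w => f (exp_sum (Z w) N)).
Proof.
rewrite (_ : (fun w => _) = (fun w => \sum_(n < N) n`!%:R^-1 * f (Z w ^+ n))).
  apply: (@rintegrable_sum _ _ _ _ _ _ (fun (n : 'I_N) w => n`!%:R^-1 * f (Z w ^+ n))) => n.
  exact: rintegrableZ.
by apply/funext => w; exact: f_exp_sum.
Qed.

Let normalized_integral n : \int[mu]_w (n`!%:R^-1 * f (Z w ^+ n)) =
  if odd n then 0 else c n./2 * f (zeta ^+ n./2).
Proof.
rewrite RintegralZl//; last exact: power_rintegrable.
rewrite power_integral; case: ifP => _; first by rewrite mulr0.
by rewrite mulrA mulVf ?mul1r// pnatr_eq0 -lt0n fact_gt0.
Qed.

Let exp_sum_integral N : \int[mu]_w f (exp_sum (Z w) N.*2) =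
  series (fun k => c k * f (zeta ^+ k)) N.
Proof.
under eq_Rintegral do rewrite f_exp_sum.
rewrite (@Rintegral_sum _ _ _ _ _ _ (fun (n : 'I_N.*2) w => n`!%:R^-1 * f (Z w ^+ n))); last first.
  by move=> n; exact: rintegrableZ.
rewrite seriesEord (sum_double (fun n => \int[mu]_w (n`!%:R^-1 * f (Z w ^+ n)))) /=.
apply: eq_bigr => k _.
by rewrite !normalized_integral /= odd_double /= doubleK addr0.
Qed.

Let Z_norm w : normc (Z w) <= `|X w| + `|Y w|.
Proof. exact: normc_le_ReIm. Qed.

Lemma laplace_part_rintegrable : rintegrable mu (fun w => f (expC (Z w))).
Proof.
apply: (rintegrable_le _ _ rintegrable_exp_norm2) => // w.
apply: (le_trans (f_le _)); rewrite /expC normcM normc_real ger0_norm ?expR_ge0//.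
rewrite [normc (_ +i* _)]/= cos2Dsin2 sqrtr1 mulr1 ler_expR.
by rewrite (le_trans (ler_norm _))// lerDl.
Qed.

(** Partial sums of even length of the exponential series are integrated: the terms of
    odd degree contribute nothing, those of degree [2k] give [c k * f (zeta ^ k)]. *)
Lemma laplace_part : \int[mu]_w f (expC (Z w)) = limn (series (fun k => c k * f (zeta ^+ k))).
Proof.
have cv : (fun N => \int[mu]_w f (exp_sum (Z w) N.*2)) @ \oo --> \int[mu]_w f (expC (Z w)).
  have := @dominated_cvg _ _ _ mu setT measurableT
    (fun N w => (f (exp_sum (Z w) N.*2))%:E) (fun w => (f (expC (Z w)))%:E)
    (fun w => (expR (`|X w| + `|Y w|))%:E).
  have E (g : T -> R) : rintegrable mu g -> (\int[mu]_w (g w)%:E)%E = (\int[mu]_w g w)%:E.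
    by move=> Ig; rewrite /Rintegral fineK//; exact: (integrable_fin_num measurableT Ig).
  rewrite (E _ laplace_part_rintegrable).
  rewrite (_ : (fun N => (\int[mu]_w (f (exp_sum (Z w) N.*2))%:E)%E) =
      EFin \o (fun N => \int[mu]_w f (exp_sum (Z w) N.*2))); last first.
    by apply/funext => N; rewrite E//; exact: exp_sum_rintegrable.
  move=> H; suff /fine_cvgP[_ ] : EFin \o (fun N => \int[mu]_w f (exp_sum (Z w) N.*2)) @ \oo -->
    (\int[mu]_w f (expC (Z w)))%:E by [].
  apply: H.
  - by move=> N; apply/measurable_EFinP; exact: measurable_rintegrable (exp_sum_rintegrable _).
  - move=> w _; apply: cvg_EFin; first exact: nearW.
    by apply: (cvg_double (u := fun N => f (exp_sum (Z w) N))); exact: f_exp.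
  - by [].
  - exact: rintegrable_exp_norm2.
  - move=> N w _; rewrite lee_fin (le_trans (f_le _))// (le_trans (normc_exp_sum_le _ _))//.
    by rewrite ler_expR Z_norm.
rewrite -(cvg_lim (@Rhausdorff R) cv); congr (limn _).
by apply/funext => N; exact: exp_sum_integral.
Qed.

End Part.

End JointLaplace.

(** * Complex differentiability of entire series *)

Section Holomorphic.
Context {R : realType}.
Implicit Types (z h : R[i]) (c : nat -> R).

Lemma mul_expr_pred_le (a : R) k : 0 <= a -> k%:R * a ^+ k.-1 <= (1 + a) ^+ k.
Proof.
move=> a0; elim: k => [|k IH]; first by rewrite mul0r expr0.
have a1 : 0 <= (1 + a) ^+ k by rewrite exprn_ge0// addr_ge0.
have ak : a ^+ k <= (1 + a) ^+ k by rewrite lerXn2r// ?nnegrE ?addr_ge0// lerDr.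
have ka : k%:R * a ^+ k <= a * (1 + a) ^+ k.
  case: k IH {a1 ak} => [|k] IH; first by rewrite mul0r mulr_ge0 ?exprn_ge0 ?addr_ge0.
  by rewrite exprS mulrCA ler_wpM2l.
by rewrite /= exprS mulrDl mul1r -natr1 mulrDl mul1r addrC lerD.
Qed.

Let rem z h k : R[i] := (z + h) ^+ k - z ^+ k - h * (k%:R * z ^+ k.-1).

(** The recursion [rem (k+1) = (z + h) rem k + h^2 k z^(k-1)] explains the base
    [2 + |z|]: it exceeds [|z + h|] by enough to absorb the last term. *)
Let rem_le z h k : normc h <= 1 -> normc (rem z h k) <= normc h ^+ 2 * (2 + normc z) ^+ k.
Proof.
move=> h1; elim: k => [|k IH].
  by rewrite /rem !expr0 mul0r mulr0 subrr subr0 normc0 mulr1 sqr_ge0.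
have -> : rem z h k.+1 = (z + h) * rem z h k + h ^+ 2 * (k%:R * z ^+ k.-1).
  rewrite /rem /= !exprS -natr1; case: k {IH} => [|k]; first by rewrite !expr0; ring.
  by rewrite /= !exprS; ring.
have h0 := normc_ge0 h; have z0 := normc_ge0 z.
apply: (le_trans (le_normcD _ _)); rewrite !normcM !normcX.
have -> : normc (k%:R : R[i]) = k%:R.
  by rewrite -(rmorph_nat (real_complex R)) normc_real normr_nat.
have zh : normc (z + h) <= normc z + 1.
  by rewrite (le_trans (le_normcD _ _))// lerD2l.
have b0 : 0 <= normc h ^+ 2 * (2 + normc z) ^+ k.
  by rewrite mulr_ge0 ?sqr_ge0// exprn_ge0// addr_ge0.
apply: (@le_trans _ _ ((normc z + 1) * (normc h ^+ 2 * (2 + normc z) ^+ k) +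
    normc h ^+ 2 * (2 + normc z) ^+ k)).
  apply: lerD; first by apply: ler_pM; rewrite ?normc_ge0.
  rewrite ler_wpM2l ?sqr_ge0// (le_trans (mul_expr_pred_le _ z0))//.
  by rewrite lerXn2r// ?nnegrE ?addr_ge0// lerD2r ler1n.
rewrite [_ ^+ k.+1]exprS; move: (normc h ^+ 2) ((2 + normc z) ^+ k) (normc z) => p q s.
by rewrite le_eqVlt; apply/orP; left; apply/eqP; ring.
Qed.

Definition cpser_derivative c z : R[i] := cser c (fun k => k%:R * z ^+ k.-1).

(** Termwise summation of [rem_le]; the linearity of the sum is that of limits. *)
Lemma cpser_taylor c z h : entire c -> normc h <= 1 ->
  normc (cpser c (z + h) - cpser c z - h * cpser_derivative c z)
    <= 2 * majorant c (2 + normc z) * normc h ^+ 2.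
Proof.
move=> ec h1; have z0 := normc_ge0 z.
have dle k : normc (k%:R * z ^+ k.-1) <= 1 * (1 + normc z) ^+ k.
  rewrite normcM normcX -(rmorph_nat (real_complex R)) normc_real normr_nat mul1r.
  exact: mul_expr_pred_le.
have z20 : 0 <= 2 + normc z by rewrite addr_ge0.
have z10 : 0 <= 1 + normc z by rewrite addr_ge0.
have c1 := cvg_cser ec (normc_ge0 (z + h)) (normcX_le (z + h)).
have c2 := cvg_cser ec z0 (normcX_le z).
have c3 := cvg_cser ec z10 dle.
have c4 := cvg_cser ec z20 (fun k => rem_le z k h1).
have -> : cpser c (z + h) - cpser c z - h * cpser_derivative c z = cser c (rem z h).
  rewrite -[RHS](cvg_lim (@norm_hausdorff _ R[i]^o) c4); apply/esym.
  apply: (cvg_lim (@norm_hausdorff _ R[i]^o)).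
  rewrite (_ : series _ = fun n => series (fun k => (c k)%:C * (z + h) ^+ k) n -
     series (fun k => (c k)%:C * z ^+ k) n -
     h * series (fun k => (c k)%:C * (k%:R * z ^+ k.-1)) n).
    apply: cvgB; first exact: cvgB c1 c2.
    by apply: cvgM; [exact: cvg_cst|exact: c3].
  apply/funext => n; rewrite /series /= mulr_sumr -!sumrB; apply: eq_bigr => k _.
  by rewrite /rem; ring.
have := normc_cser_le ec z20 (fun k => rem_le z k h1).
by rewrite -mulrA [normc h ^+ 2 * _]mulrC.
Qed.

Lemma derivable_cpser c z : entire c -> derivable (cpser c : R[i]^o -> R[i]^o) z 1.
Proof.
move=> ec; apply: (cvgP (cpser_derivative c z : R[i]^o)).
pose M := 2 * majorant c (2 + normc z).
have M0 : 0 <= M by rewrite mulr_ge0// majorant_ge0// addr_ge0// normc_ge0.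
apply/cvgrPdist_lt => e e0.
have {e0} [e0 ->] : 0 < complex.Re e /\ e = (complex.Re e)%:C.
  by move: e e0 => [er ei]; rewrite ltcE /= => /andP[/eqP-> ?]; split.
pose del := Num.min 1 (complex.Re e / (M + 1)).
have del0 : 0 < del by rewrite lt_min ltr01 divr_gt0// ltr_wpDl.
near=> h.
have hn0 : h != 0 by near: h; exact: nbhs_dnbhs_neq.
have : `|h| < del%:C by near: h; apply: dnbhs0_lt; rewrite ltcR.
rewrite normc_normE ltcR lt_min => /andP[h1 he].
rewrite normc_normE ltcR.
have hn : normc h != 0 by apply: contra_neq hn0 => /eq0_normc.
have hp : 0 < normc h by rewrite lt_neqAle eq_sym hn normc_ge0.
have -> : cpser_derivative c z - h^-1 *: ((cpser c \o shift z) (h *: 1) - cpser c z) =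
   - h^-1 * (cpser c (z + h) - cpser c z - h * cpser_derivative c z).
  rewrite /= [h *: 1]mulr1 [h + z]addrC.
  by rewrite -[_ *: _]/(h^-1 * _) mulNr [in RHS]mulrBr mulKf// opprB.
rewrite normcM normcN normcV mulrC ltr_pdivrMr//.
apply: (le_lt_trans (cpser_taylor z ec (ltW h1))); rewrite -/M expr2 mulrA ltr_pM2r//.
rewrite ltr_pdivlMr ?ltr_wpDl// in he.
apply: le_lt_trans he; rewrite mulrC ler_wpM2l ?normc_ge0//.
by rewrite lerDl.
Unshelve. all: by end_near. Qed.

Lemma derivable_cpser_quadratic c (q0 q1 q2 z : R[i]) : entire c ->
  derivable ((fun y => cpser c (q0 + y * q1 + y ^+ 2 * q2)) : R[i]^o -> R[i]^o) z 1.
Proof.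
move=> ec; apply/derivable1_diffP.
apply: (@differentiable_comp _ R[i]^o R[i]^o R[i]^o
  (fun y => q0 + y * q1 + y ^+ 2 * q2) (cpser c)); last first.
  by apply/derivable1_diffP; exact: derivable_cpser.
apply/derivable1_diffP.
apply: derivableD; first apply: derivableD; first exact: derivable_cst.
  by apply: derivableM; [exact: derivable_id|exact: derivable_cst].
by apply: derivableM; [exact: exprn_derivable|exact: derivable_cst].
Qed.

End Holomorphic.

(** * The Laplace transform on the nuclear triple *)

Section InnerProduct.
Context {R : realType} (T : nuclearTriple R).
Implicit Types (phi psi : Nsp T) (theta eta : N_C T).

Lemma inner0C phi psi : inner0 phi psi = inner0 psi phi.
Proof. by rewrite /inner0 hermC /= expr0 mul1r. Qed.

Lemma inner0Dl phi psi chi : inner0 (phi + psi) chi = inner0 phi chi + inner0 psi chi.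
Proof. by rewrite /inner0 linearD linearDl. Qed.

Lemma inner0Zl (x : R) phi psi : inner0 (x *: phi) psi = x * inner0 phi psi.
Proof. by rewrite /inner0 linearZ linearZl. Qed.

Lemma inner0Bl phi psi chi : inner0 (phi - psi) chi = inner0 phi chi - inner0 psi chi.
Proof. by rewrite /inner0 linearB linearBl. Qed.

Lemma inner0_0l phi : inner0 0 phi = 0.
Proof. by rewrite /inner0 linear0 linear0l. Qed.

Lemma inner0_norm phi : inner0 phi phi = `|emb T 0 phi| ^+ 2.
Proof. by rewrite /inner0 inner_norm. Qed.

Lemma cinner0C theta eta : cinner0 theta eta = cinner0 eta theta.
Proof.
rewrite /cinner0 (inner0C theta.1) (inner0C theta.2 eta.2) (inner0C theta.1 eta.2).
by rewrite (inner0C theta.2 eta.1) addrC [X in _ +i* X]addrC.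
Qed.

Lemma cinner0Dl theta theta' eta :
  cinner0 (theta + theta') eta = cinner0 theta eta + cinner0 theta' eta.
Proof.
apply/eqP; rewrite eq_complex /= !inner0Dl opprD.
by apply/andP; split; apply/eqP; exact: addrACA.
Qed.

Lemma cinner0Zl (z : R[i]) theta eta : cinner0 (z *: theta) eta = z * cinner0 theta eta.
Proof.
case: z => x y; apply/eqP; rewrite eq_complex /= inner0Bl inner0Dl !(inner0Bl, inner0Dl, inner0Zl).
by apply/andP; split; apply/eqP; ring.
Qed.

Lemma cinner0_sqr_scale (z : R[i]) theta :
  cinner0 (z *: theta) (z *: theta) = z ^+ 2 * cinner0 theta theta.
Proof. by rewrite cinner0Zl cinner0C cinner0Zl mulrA. Qed.

Lemma cinner0_sqr_add (y : R[i]) theta eta :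
  cinner0 (theta + y *: eta) (theta + y *: eta) =
  cinner0 theta theta + y * (2 * cinner0 theta eta) + y ^+ 2 * cinner0 eta eta.
Proof.
rewrite cinner0Dl ![cinner0 _ (_ + _)]cinner0C !cinner0Dl !cinner0Zl.
rewrite [cinner0 theta (y *: eta)]cinner0C [cinner0 eta (y *: eta)]cinner0C !cinner0Zl.
by rewrite [cinner0 eta theta]cinner0C; ring.
Qed.

(** The imaginary part [2 <x, y>] is controlled by positivity of the form at [x + y]
    and [x - y]. *)
Lemma normc_cinner0_le theta :
  normc (cinner0 theta theta / 2) <= `|emb T 0 theta.1| ^+ 2 + `|emb T 0 theta.2| ^+ 2.
Proof.
have -> : 2 = (2 : R)%:C :> R[i] by rewrite rmorph_nat.
rewrite normcM normcV normc_real (ger0_norm (_ : 0 <= 2))// ler_pdivrMr//.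
rewrite (le_trans (normc_le_ReIm _))// /cinner0 /= (inner0C theta.2) -!inner0_norm.
set a := inner0 theta.1 theta.1; set c := inner0 theta.2 theta.2.
set b := inner0 theta.1 theta.2.
have a0 : 0 <= a by rewrite /a inner0_norm sqr_ge0.
have c0 : 0 <= c by rewrite /c inner0_norm sqr_ge0.
have plus (x : R) : 0 <= a + 2 * x * b + x ^+ 2 * c.
  have : 0 <= inner0 (theta.1 + x *: theta.2) (theta.1 + x *: theta.2).
    by rewrite inner0_norm sqr_ge0.
  rewrite inner0Dl ![inner0 _ (_ + _)]inner0C !inner0Dl !inner0Zl.
  rewrite [inner0 theta.1 (x *: _)]inner0C [inner0 theta.2 (x *: _)]inner0C !inner0Zl.
  by rewrite (inner0C theta.2 theta.1) -/a -/b -/c => /le_trans; apply; lra.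
have p1 := plus 1; have p2 := plus (-1).
have : `|a - c| <= a + c by rewrite ler_norml; lra.
have : `|b + b| <= a + c by rewrite ler_norml; lra.
by lra.
Qed.

End InnerProduct.

Section WrightLaplace.
Context {R : realType} (T : nuclearTriple R) (mu : probability (cdual (Nsp T)) R).

(** Such evaluations generate the cylinder sigma-algebra. *)
Lemma measurable_pairing (phi : Nsp T) :
  measurable_fun setT (fun w : cdual (Nsp T) => pairing w phi).
Proof.
move=> _ B mB; rewrite setTI; apply: sub_sigma_algebra.
by exists phi, B.
Qed.

Lemma pairingD (w : cdual (Nsp T)) phi psi : pairing w (phi + psi) = pairing w phi + pairing w psi.
Proof. by rewrite /pairing linearD. Qed.

Lemma pairingB (w : cdual (Nsp T)) phi psi : pairing w (phi - psi) = pairing w phi - pairing w psi.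
Proof. by rewrite /pairing linearB. Qed.

Lemma pairingZ (w : cdual (Nsp T)) (x : R) phi : pairing w (x *: phi) = x * pairing w phi.
Proof. by rewrite /pairing linearZ. Qed.

Lemma cpairingZ (w : cdual (Nsp T)) (z : R[i]) (theta : N_C T) :
  cpairing w (z *: theta) = z * cpairing w theta.
Proof.
case: z => x y; apply/eqP; rewrite eq_complex /= pairingB pairingD !pairingZ.
by rewrite !eqxx.
Qed.

Variable c : nat -> R.
Hypothesis entire_c : entire c.
Hypothesis characteristic_function : forall phi : Nsp T,
  cintegral mu setT (fun w => expC ('i * (pairing w phi)%:C)) =
  cpser c (- (inner0 phi phi)%:C / 2).

Let cos_sin_integral (phi : Nsp T) :
  \int[mu]_w cos (pairing w phi) = limn (series (fun k => c k * (- (inner0 phi phi) / 2) ^+ k)) /\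
  \int[mu]_w sin (pairing w phi) = 0.
Proof.
have E w : expC ('i * (pairing w phi)%:C) = cos (pairing w phi) +i* sin (pairing w phi).
  rewrite /expC /= !mul0r !mul1r sub0r oppr0 add0r expR0.
  by apply/eqP; rewrite eq_complex /= !mul0r !mul1r subr0 addr0 !eqxx.
have := characteristic_function phi.
have -> : - (inner0 phi phi)%:C / 2 = (- inner0 phi phi / 2)%:C.
  by rewrite rmorphM rmorphN fmorphV rmorph_nat.
have -> : cintegral mu setT (fun w => expC ('i * (pairing w phi)%:C)) =
    (\int[mu]_w cos (pairing w phi)) +i* (\int[mu]_w sin (pairing w phi)).
  congr (_ +i* _); apply: eq_Rintegral => w _.
    exact: (congr1 (@complex.Re R) (E w)).
  exact: (congr1 (@complex.Im R) (E w)).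
by rewrite cpser_real => -[-> ->].
Qed.

Section Joint.
Variables phi psi : Nsp T.
Let A := inner0 phi phi.
Let B := inner0 phi psi.
Let C := inner0 psi psi.

Let combE (w : cdual (Nsp T)) (u v t : R) :
  pairing w (t *: (u *: phi + v *: psi)) = t * (u * pairing w phi + v * pairing w psi).
Proof. by rewrite pairingZ pairingD !pairingZ. Qed.

Let inner_comb (u v t : R) :
  inner0 (t *: (u *: phi + v *: psi)) (t *: (u *: phi + v *: psi)) =
  t ^+ 2 * (u ^+ 2 * A + 2 * (u * v) * B + v ^+ 2 * C).
Proof.
rewrite inner0Zl inner0C inner0Zl mulrA -expr2; congr (_ * _).
rewrite inner0Dl ![inner0 _ (_ + _)]inner0C !inner0Dl !inner0Zl.
rewrite ![inner0 _ (_ *: _)]inner0C !inner0Zl (inner0C psi phi) -/A -/B -/C.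
by ring.
Qed.

Lemma cos_integral (u v t : R) :
  \int[mu]_w cos (t * (u * pairing w phi + v * pairing w psi)) =
  limn (series (fun k => c k * ((u ^+ 2 * A + 2 * (u * v) * B + v ^+ 2 * C) / 2) ^+ k
    * (- t ^+ 2) ^+ k)).
Proof.
under eq_Rintegral do rewrite -combE.
have [-> _] := cos_sin_integral (t *: (u *: phi + v *: psi)).
congr (limn (series _)); apply/funext => k; rewrite inner_comb -[RHS]mulrA -exprMn.
by congr (_ * _ ^+ _); field.
Qed.

Lemma sin_integral (u v t : R) :
  \int[mu]_w sin (t * (u * pairing w phi + v * pairing w psi)) = 0.
Proof.
under eq_Rintegral do rewrite -combE.
by have [_ ->] := cos_sin_integral (t *: (u *: phi + v *: psi)).
Qed.

Lemma exp_norm_pairing_rintegrable :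
  rintegrable mu (fun w => expR (`|pairing w phi| + `|pairing w psi|)).
Proof.
exact: (rintegrable_exp_norm2 (measurable_pairing phi) (measurable_pairing psi)
  entire_c cos_integral sin_integral).
Qed.

Let zeta : cinner0 (phi, psi) (phi, psi) / 2 = ((A - C) / 2) +i* B.
Proof.
have -> : 2 = (2 : R)%:C :> R[i] by rewrite rmorph_nat.
rewrite -fmorphV mulrC /cinner0 /= (inner0C psi phi) -/A -/B -/C.
apply/eqP; rewrite eq_complex Re_realM Im_realM /=.
by apply/andP; split; apply/eqP; field.
Qed.

Lemma laplace_pair :
  cintegrable mu setT (fun w => expC (pairing w phi +i* pairing w psi)) /\
  cintegral mu setT (fun w => expC (pairing w phi +i* pairing w psi)) =
    cpser c (cinner0 (phi, psi) (phi, psi) / 2).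
Proof.
have mX := measurable_pairing phi; have mY := measurable_pairing psi.
have mRe : measurable_fun setT (fun w : cdual (Nsp T) =>
    complex.Re (expC (pairing w phi +i* pairing w psi))).
  under eq_fun do rewrite /expC Re_realM /=.
  apply: measurable_funM; first exact: measurableT_comp.
  apply: measurableT_comp => //.
  by apply: continuous_measurable_fun; exact: continuous_cos.
have mIm : measurable_fun setT (fun w : cdual (Nsp T) =>
    complex.Im (expC (pairing w phi +i* pairing w psi))).
  under eq_fun do rewrite /expC Im_realM /=.
  apply: measurable_funM; first exact: measurableT_comp.
  apply: measurableT_comp => //.
  by apply: continuous_measurable_fun; exact: continuous_sin.
have ReD (z z' : R[i]) : complex.Re (z + z') = complex.Re z + complex.Re z' by case: z z' => ? ? [].
have ImD (z z' : R[i]) : complex.Im (z + z') = complex.Im z + complex.Im z' by case: z z' => ? ? [].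
have Re_exp z := (@cvg_exp_sum_complex R z).1.
have Im_exp z := (@cvg_exp_sum_complex R z).2.
have IRe := laplace_part_rintegrable mX mY entire_c cos_integral sin_integral
  (@Re_le_normc R) mRe.
have IIm := laplace_part_rintegrable mX mY entire_c cos_integral sin_integral
  (@Im_le_normc R) mIm.
split; first by split.
rewrite zeta /cpser /cser /cintegral; congr (_ +i* _).
  exact: (laplace_part mX mY entire_c cos_integral sin_integral ReD (@Re_realM R)
    (@Re_le_normc R) Re_exp mRe).
exact: (laplace_part mX mY entire_c cos_integral sin_integral ImD (@Im_realM R)
  (@Im_le_normc R) Im_exp mIm).
Qed.

End Joint.

Lemma laplace_formula (theta : N_C T) : laplace mu theta = cpser c (cinner0 theta theta / 2).
Proof. by case: theta => phi psi; exact: (laplace_pair phi psi).2. Qed.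

(** On a complex line the quadratic form is a quadratic polynomial; on the product of
    two balls of radius 1 for the norm of the Hilbert space it is bounded. *)
Lemma holomorphic_laplace : holomorphic (laplace mu).
Proof.
have -> : laplace mu = fun theta => cpser c (cinner0 theta theta / 2).
  by apply/funext => theta; exact: laplace_formula.
split.
  move=> theta eta z.
  rewrite (_ : (fun y => _) = (fun y : R[i] => cpser c (cinner0 theta theta / 2 +
      y * (cinner0 theta eta) + y ^+ 2 * (cinner0 eta eta / 2)))).
    exact: derivable_cpser_quadratic.
  apply/funext => y; congr (cpser c _); rewrite cinner0_sqr_add.
  by field.
move=> theta.
pose rho := (`|emb T 0 theta.1| + 1) ^+ 2 + (`|emb T 0 theta.2| + 1) ^+ 2.
exists (2 * majorant c rho)%:C.
have near_bound (phi : Nsp T) : \forall psi \near phi, `|emb T 0 psi| <= `|emb T 0 phi| + 1.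
  apply/emb_nbhs; exists 0%N, 1; split => // psi /= H.
  rewrite -[psi](subrK phi) linearD addrC (le_trans (ler_normD _ _))// lerD2l ltW//.
have : nbhs theta [set eta : N_C T | `|emb T 0 eta.1| <= `|emb T 0 theta.1| + 1 /\
    `|emb T 0 eta.2| <= `|emb T 0 theta.2| + 1].
  exists ([set psi | `|emb T 0 psi| <= `|emb T 0 theta.1| + 1],
          [set psi | `|emb T 0 psi| <= `|emb T 0 theta.2| + 1]) => //=.
  by split; exact: near_bound.
apply: filterS => eta [e1 e2].
rewrite normc_normE lecR (le_trans (normc_cpser_le _ entire_c))// ler_wpM2l//.
apply: majorant_le => //; first exact: normc_ge0.
apply: (le_trans (normc_cinner0_le eta)).
by rewrite /rho lerD// lerXn2r// nnegrE// addr_ge0.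
Qed.

End WrightLaplace.

Theorem theorem4p1 (R : realType) (m p : nat)
    (a alpha : 'I_p -> R) (b beta : 'I_m -> R) (gamma : R)
    (alpha_gt0 : forall i, 0 < alpha i) (a_alpha_gt0 : forall i, 0 < a i + alpha i)
    (beta_gt0 : forall j, 0 < beta j) (b_beta_gt0 : forall j, 0 < b j + beta j)
    (astar_gt0 : 0 < \sum_j beta j - \sum_i alpha i)
    (astar_lt1 : \sum_j beta j - \sum_i alpha i < 1)
    (gamma_gt0 : 0 < gamma) (gamma_lt1 : gamma < 1)
    (gamma_poles : poles_left_of b beta gamma)
    (foxH_ge0 : forall tau : R, 0 < tau -> 0 <= foxH a alpha b beta gamma tau)
    (T : nuclearTriple R) (mu : probability (cdual (Nsp T)) R)
    (mu_wright : is_wright_measure mu a alpha b beta) :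
  (forall (phi : Nsp T) (lambda : R),
    mu.-integrable setT (fun w => (expR `|lambda * pairing w phi|)%:E) /\
    laplace mu (toC (lambda *: phi)) =
      (\int[mu]_w expR (lambda * pairing w phi))%:C /\
    (\int[mu]_w expR (lambda * pairing w phi))%:C =
      (wrightK a alpha b beta)^-1 *
        wrightPsi a alpha b beta ((lambda ^+ 2 * inner0 phi phi)%:C / 2)) /\
  holomorphic (laplace mu) /\
  (forall (theta : N_C T) (z : R[i]),
    cintegrable mu setT (fun w => expC (z * cpairing w theta)) /\
    cintegral mu setT (fun w => expC (z * cpairing w theta)) =
      (wrightK a alpha b beta)^-1 *
        wrightPsi a alpha b beta (z ^+ 2 * cinner0 theta theta / 2)).
Proof.
have ec : entire (wright_coef a alpha b beta) by exact: entire_wright_coef.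
have PsiE z := wrightPsi_cpser alpha_gt0 a_alpha_gt0 beta_gt0 b_beta_gt0 astar_lt1 z.
have cf (phi : Nsp T) : cintegral mu setT (fun w => expC ('i * (pairing w phi)%:C)) =
    cpser (wright_coef a alpha b beta) (- (inner0 phi phi)%:C / 2).
  by rewrite mu_wright PsiE.
split; last split.
- move=> phi lambda.
  have real_exp w : expC (cpairing w (toC (lambda *: phi))) =
      (expR (lambda * pairing w phi))%:C.
    have pairing0 : pairing w (0 : Nsp T) = 0 by rewrite /pairing linear0.
    by rewrite /cpairing /= pairing0 pairingZ -expC_real.
  have lapE : laplace mu (toC (lambda *: phi)) = (\int[mu]_w expR (lambda * pairing w phi))%:C.
    rewrite /laplace /cintegral; congr (_ +i* _).
      by apply: eq_Rintegral => w _; exact: (congr1 (@complex.Re R) (real_exp w)).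
    transitivity (\int[mu]_w (0 : R)); last by rewrite Rintegral_cst// mul0r.
    by apply: eq_Rintegral => w _; exact: (congr1 (@complex.Im R) (real_exp w)).
  split; [|split=> //].
    have := exp_norm_pairing_rintegrable ec cf (lambda *: phi) 0.
    congr (rintegrable mu _); apply/funext => w.
    by rewrite -[0]/(0 : Nsp T) pairingZ /pairing linear0 normr0 addr0.
  rewrite -lapE PsiE (laplace_formula ec cf); congr (cpser _ (_ / 2)).
  apply/eqP; rewrite eq_complex /=; apply/andP; split; apply/eqP.
    by rewrite inner0Zl inner0C inner0Zl inner0_0l subr0 mulrA expr2.
  by rewrite inner0C !inner0_0l addr0.
- exact: holomorphic_laplace ec cf.
- move=> theta z.
  have E w : z * cpairing w theta = cpairing w (z *: theta) by rewrite cpairingZ.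
  under eq_fun do rewrite E.
  rewrite PsiE -cinner0_sqr_scale; case: (z *: theta) => phi psi.
  exact: laplace_pair ec cf phi psi.
Qed.
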